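(* Let $F$ be a function field in one variable over $\mathbb{C}$ of genus $\mathfrak{g}$. Let $G_n = a_1 \alpha_1^n + \cdots + a_d \alpha_d^n$ and $H_m = b_1 \beta_1^m + \cdots + b_t \beta_t^m$ be two simple linear recurrence sequences with $a_i, \alpha_i, b_j, \beta_j \in F^*$ for $i=1,\ldots,d$ and $j=1,\ldots,t$. Assume that no $\alpha_i$ and no $\beta_j$ lies in $\mathbb{C}$, and that no ratio $\alpha_i/\alpha_j$ or $\beta_i/\beta_j$ with $i \neq j$ lies in $\mathbb{C}$. Let $f \in F^*$ be a given non-zero element. Then there exists an effectively computable constant $C$, depending only on the $a_i, \alpha_i, b_j, \beta_j$, $f$ and $\mathfrak{g}$, such that every $(n,m) \in \mathbb{N}^2$ with $G_n - H_m = f$ satisfies $\max\{n,m\} \leq C$.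
   Context: $\mathbb{N}$ denotes the set of positive integers. A function field in one variable over $\mathbb{C}$ is a finite extension of the rational function field $\mathbb{C}(x)$. *)

(* Defs.v *)
From HB Require Import structures.
From mathcomp Require Import all_boot all_order all_algebra all_field.
From mathcomp Require Import boolp reals.
From mathcomp Require Export complex.
From mathcomp Require Export freeg.

Set Implicit Arguments.
Unset Strict Implicit.
Unset Printing Implicit Defensive.

Import Order.TTheory GRing.Theory Num.Theory.

Local Open Scope ring_scope.

(* The rational function field K(x). A function field in one variable over K
   is then an F : fieldExtType (ratfun K), i.e. a finite extension of K(x). *)
Notation ratfun K := {fraction {poly K}}.

Section FunctionField.
Variables (K : fieldType) (F : fieldExtType (ratfun K)).

Definition const_ff (c : K) : F := (FracField.tofrac c%:P)%:A.

Definition is_const (u : F) : Prop := exists c : K, u = const_ff c.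

(* A place is given by its normalized discrete valuation, trivial on K. The
   valuation of 0, which should be +oo, is set to the junk value 0 so that
   distinct records are distinct places; every axiom avoids it. *)
Record place := Place {
  val_at :> F -> int;
  val_at0 : val_at 0 = 0;
  val_atM : forall u v, u != 0 -> v != 0 -> val_at (u * v) = val_at u + val_at v;
  val_atD : forall u v, u != 0 -> v != 0 -> u + v != 0 ->
    Order.min (val_at u) (val_at v) <= val_at (u + v);
  val_at_const : forall c, val_at (const_ff c) = 0;
  val_at_norm : exists u, val_at u = 1 }.

HB.instance Definition _ := gen_eqMixin place.
HB.instance Definition _ := gen_choiceMixin place.

(* Over an algebraically closed K every place has degree 1, so the degree of a
   divisor is the sum [deg D] of its coefficients. *)
Definition divisor := {freeg place / int}.

(* The Riemann-Roch space L(D). *)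
Definition RRspace (D : divisor) (u : F) : Prop :=
  u = 0 \/ forall v : place, - coeff v D <= v u.

Definition RRdim (D : divisor) (l : nat) : Prop :=
  exists e : 'I_l -> F,
    (forall u : F, RRspace D u <->
       exists c : 'I_l -> K, u = \sum_(i < l) const_ff (c i) * e i) /\
    (forall c : 'I_l -> K, \sum_(i < l) const_ff (c i) * e i = 0 ->
       forall i, c i = 0).

(* g = max_D (deg D - dim L(D) + 1), for K algebraically closed. *)
Definition is_genus (g : nat) : Prop :=
  (forall (D : divisor) (l : nat), RRdim D l -> deg D - l%:Z + 1 <= g%:Z) /\
  (exists (D : divisor) (l : nat), RRdim D l /\ deg D - l%:Z + 1 = g%:Z).

End FunctionField.

(* Effective computability over K. The data are finite binary trees with leaves
   in K; programs are while-programs whose only access to K is through the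
   constant 1, the field operations and the test for 0. This is computability
   by Blum-Shub-Smale machines over K without machine constants. No constant of
   K other than 1 may occur in a program, as it could carry an infinite amount
   of information. *)
Inductive tree (K : Type) : Type :=
  | Nil
  | Leaf of K
  | Pair of tree K & tree K.

Arguments Nil {K}.

Inductive prog : Type :=
  | PId
  | PNil
  | POne
  | PPair of prog & prog
  | PFst
  | PSnd
  | PAdd
  | POpp
  | PMul
  | PInv
  | PIsZero
  | PIsPair
  | PComp of prog & prog
  | PIf of prog & prog & prog
  | PWhile of prog & prog.

Section Programs.
Variable K : fieldType.
Implicit Types (p q r : prog) (x y z : tree K).

Definition tree_bool (b : bool) : tree K := if b then Pair Nil Nil else Nil.

Definition tfst x := if x is Pair y _ then y else Nil.
Definition tsnd x := if x is Pair _ z then z else Nil.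
Definition tadd x :=
  if x is Pair (Leaf a) (Leaf b) then Leaf (a + b) else Nil.
Definition topp x := if x is Leaf a then Leaf (- a) else Nil.
Definition tmul x :=
  if x is Pair (Leaf a) (Leaf b) then Leaf (a * b) else Nil.
Definition tinv x := if x is Leaf a then Leaf a^-1 else Nil.
Definition tis_zero x := tree_bool (if x is Leaf a then a == 0 else false).
Definition tis_pair x := tree_bool (if x is Pair _ _ then true else false).

(* [runs p x y]: started on the input x, the program p halts with output y.
   In tests, Nil is false and every other tree is true. *)
Inductive runs : prog -> tree K -> tree K -> Prop :=
  | RId x : runs PId x x
  | RNil x : runs PNil x Nil
  | ROne x : runs POne x (Leaf 1)
  | RPair p q x y z : runs p x y -> runs q x z -> runs (PPair p q) x (Pair y z)
  | RFst x : runs PFst x (tfst x)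
  | RSnd x : runs PSnd x (tsnd x)
  | RAdd x : runs PAdd x (tadd x)
  | ROpp x : runs POpp x (topp x)
  | RMul x : runs PMul x (tmul x)
  | RInv x : runs PInv x (tinv x)
  | RIsZero x : runs PIsZero x (tis_zero x)
  | RIsPair x : runs PIsPair x (tis_pair x)
  | RComp p q x y z : runs q x y -> runs p y z -> runs (PComp p q) x z
  | RIfT p q r x y z :
      runs p x y -> y <> Nil -> runs q x z -> runs (PIf p q r) x z
  | RIfF p q r x z : runs p x Nil -> runs r x z -> runs (PIf p q r) x z
  | RWhileT p q x y z t :
      runs p x y -> y <> Nil -> runs q x z -> runs (PWhile p q) z t ->
      runs (PWhile p q) x t
  | RWhileF p q x : runs p x Nil -> runs (PWhile p q) x x.

Definition enc_seq (s : seq (tree K)) : tree K := foldr (@Pair K) Nil s.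

Definition enc_nat (n : nat) : tree K := enc_seq (nseq n Nil).

Definition enc_poly (p : {poly K}) : tree K :=
  enc_seq [seq Leaf c | c <- polyseq p].

End Programs.

(* The numerator and the denominator of r in lowest terms, with monic
   denominator. *)
Definition frac_num (K : fieldType) (r : ratfun K) : {poly K} :=
  let n := \n_(repr r) in let d := \d_(repr r) in
  (lead_coef (d %/ gcdp n d))^-1 *: (n %/ gcdp n d).

Definition frac_den (K : fieldType) (r : ratfun K) : {poly K} :=
  let n := \n_(repr r) in let d := \d_(repr r) in
  (lead_coef (d %/ gcdp n d))^-1 *: (d %/ gcdp n d).

Lemma frac_num_den (K : fieldType) (r : ratfun K) :
  [/\ r = FracField.tofrac (frac_num r) / FracField.tofrac (frac_den r),
      coprimep (frac_num r) (frac_den r) & frac_den r \is monic].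
Proof.
have d0 : \d_(repr r) != 0 := denom_ratioP _.
have dg : gcdp \n_(repr r) \d_(repr r) %| \d_(repr r) := dvdp_gcdr _ _.
have ng : gcdp \n_(repr r) \d_(repr r) %| \n_(repr r) := dvdp_gcdl _ _.
have q0 : \d_(repr r) %/ gcdp \n_(repr r) \d_(repr r) != 0.
  by rewrite dvdp_div_eq0.
have l0 : (lead_coef (\d_(repr r) %/ gcdp \n_(repr r) \d_(repr r)))^-1 != 0.
  by rewrite invr_eq0 lead_coef_eq0.
have D0 : FracField.tofrac (frac_den r) != 0.
  by rewrite tofrac_eq0 scale_poly_eq0 negb_or l0.
split; last by rewrite monicE lead_coefZ mulVf // lead_coef_eq0.
  have d0' : FracField.tofrac \d_(repr r) != 0 by rewrite tofrac_eq0.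
  have rE : r = FracField.tofrac \n_(repr r) / FracField.tofrac \d_(repr r).
    apply: (mulIf d0'); rewrite mulfVK // -{1}[r]reprK.
    unlock FracField.tofrac; rewrite -[LHS]FracField.pi_mul.
    apply/eqmodP; rewrite /= FracField.equivfE /FracField.mulf.
    rewrite !numden_Ratio ?mulf_neq0 ?oner_neq0 //.
    by rewrite !mulr1 mulrC.
  rewrite [LHS]rE; apply: (canLR (mulfK d0')); rewrite mulrAC.
  apply: (canRL (mulfK D0)); rewrite -!tofracM; apply: congr1.
  rewrite /frac_num /frac_den.
  move: ng dg; set n := \n_(repr r); set d := \d_(repr r); set h := gcdp n d.
  set c := (lead_coef _)^-1 => ng dg.
  rewrite -!scalerAl -!scalerAr; congr (_ *: _).
  rewrite -[X in X * _ = _](divpK ng) -[X in _ = _ * X](divpK dg).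
  by rewrite mulrAC mulrA.
by rewrite coprimepZl // coprimepZr // coprimep_div_gcd // d0 orbT.
Qed.

Section Encoding.
Variables (K : fieldType) (F : fieldExtType (ratfun K)).

Definition enc_ratfun (r : ratfun K) : tree K :=
  Pair (enc_poly (frac_num r)) (enc_poly (frac_den r)).

(* The basis of F over K(x) carried by the vector space structure of F; every
   basis arises in this way from some such structure. *)
Definition ff_basis : (\dim {:F}).-tuple F := vbasis {:F}.

Definition enc_elt (u : F) : tree K :=
  enc_seq [seq enc_ratfun (coord ff_basis i u) | i <- enum 'I_(\dim {:F})].

Definition enc_elts (d : nat) (u : 'I_d -> F) : tree K :=
  enc_seq [seq enc_elt (u i) | i <- enum 'I_d].

(* F itself is described by its multiplication table. *)
Definition enc_field : tree K :=
  enc_seq [seq enc_elts (fun j => tnth ff_basis i * tnth ff_basis j)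
          | i <- enum 'I_(\dim {:F})].

Definition enc_data (d t g : nat) (a alpha : 'I_d -> F) (b beta : 'I_t -> F)
    (f : F) : tree K :=
  enc_seq [:: enc_field; enc_elts a; enc_elts alpha; enc_elts b; enc_elts beta;
              enc_elt f; enc_nat K g].

End Encoding.

Definition slrs (F : pzSemiRingType) (d : nat) (a alpha : 'I_d -> F) (n : nat) : F :=
  \sum_(i < d) a i * alpha i ^+ n.

(* Main.v *)
(* Measure u in F by the degree of the matrix of multiplication by u over C(x);
   this height is subadditive. Let D be the extension of d/dx to F. The
   logarithmic derivative of a * alpha^n is D a / a + n * (D alpha / alpha), so
   its height is bounded independently of n. For a given term of the vanishing
   sum G_n - H_m - f = 0 take a C-linear relation of minimal support through it.
   The other terms of that relation, divided by the given one, are v_1, ..., v_r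
   with c_1 v_1 + ... + c_r v_r = 1. They are linearly independent over C, hence
   have a nonzero Wronskian, and Cramer's rule applied to the derivatives of
   this equation expresses c_i v_i through the quotients D^j v_i / v_i, which
   have bounded height. So each term has a ratio of bounded height with some
   other term, without Riemann-Hurwitz or the genus.

   If alpha is not constant and alpha^n has height at most E, then n is bounded:
   for generic w, each of the n roots t of t^n = w is an eigenvalue of the matrix
   of alpha at some point of the x-line, where w is an eigenvalue of the matrix
   of alpha^n; there are at most N * E such points, N = [F : C(x)], with at most
   N eigenvalues each.

   Applied to the term f this bounds n or m, and applied to a term of the other
   sequence it then bounds the other exponent. All bounds are explicit functions
   of the number of nodes of the input tree, which a program can evaluate. *)

From HB Require Import structures.
Require Import Defs.
From mathcomp Require Import all_boot all_order all_fingroup all_algebra all_field.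
From mathcomp Require Import boolp reals.
From mathcomp Require Import zify ring.

Set Implicit Arguments.
Unset Strict Implicit.
Unset Printing Implicit Defensive.

Import GRing.Theory.

Local Open Scope ring_scope.

(** * Programs on unary numbers *)

Section Computability.
Local Open Scope nat_scope.
Variable K : fieldType.

Fixpoint tree_size (x : tree K) : nat :=
  if x is Pair y z then (tree_size y + tree_size z).+1 else 1.

Definition computes (p : prog) (h : nat -> nat) : Prop :=
  forall n, runs p (enc_nat K n) (enc_nat K (h n)).

Lemma enc_natS n : enc_nat K n.+1 = Pair Defs.Nil (enc_nat K n).
Proof. by []. Qed.

Lemma runs_fst (y z : tree K) : runs PFst (Pair y z) y.
Proof. exact: (RFst (Pair y z)). Qed.

Lemma runs_snd (y z : tree K) : runs PSnd (Pair y z) z.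
Proof. exact: (RSnd (Pair y z)). Qed.

Definition psucc : prog := PPair PNil PId.

Lemma computes_id : computes PId id.
Proof. by move=> n; constructor. Qed.

Fixpoint pconst (c : nat) : prog :=
  if c is c'.+1 then PComp psucc (pconst c') else PNil.

Lemma runs_pconst c (x : tree K) : runs (pconst c) x (enc_nat K c).
Proof.
elim: c => [|c IHc] /=; first exact: RNil.
apply: RComp IHc _; rewrite enc_natS.
by apply: RPair; constructor.
Qed.

Lemma computes_const c : computes (pconst c) (fun=> c).
Proof. by move=> n; exact: runs_pconst. Qed.

(* The input consists of a unary counter, a parameter for [p] and the initial
   value of the iteration. *)
Definition ploop (p : prog) : prog :=
  PComp PSnd
    (PWhile PFst (PPair (PComp PSnd PFst)
                        (PPair (PComp PFst PSnd) (PComp p PSnd)))).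

Lemma runs_loop p y (g : nat -> nat) n x :
  (forall k, runs p (Pair y (enc_nat K k)) (enc_nat K (g k))) ->
  runs (ploop p) (Pair (enc_nat K n) (Pair y (enc_nat K x)))
    (Pair y (enc_nat K (iter n g x))).
Proof.
move=> pg; apply: RComp (runs_snd _ _).
elim: n x => [|n IHn] x; first exact: RWhileF (runs_fst _ _).
rewrite iterSr enc_natS; apply: RWhileT (runs_fst _ _) _ _ (IHn _) => //.
apply: RPair; first exact: RComp (runs_fst _ _) (runs_snd _ _).
apply: RPair; first exact: RComp (runs_snd _ _) (runs_fst _ _).
exact: RComp (runs_snd _ _) (pg x).
Qed.

Definition padd (p q : prog) : prog :=
  PComp PSnd (PComp (ploop (PComp psucc PSnd)) (PPair p (PPair PNil q))).

Lemma runs_add p q x m n :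
  runs p x (enc_nat K m) -> runs q x (enc_nat K n) ->
  runs (padd p q) x (enc_nat K (m + n)).
Proof.
move=> pm qn; apply: RComp (runs_snd _ _).
apply: RComp; first by apply: RPair pm _; apply: RPair (RNil _) qn.
rewrite addnC -iter_succn; apply: runs_loop => k.
apply: RComp (runs_snd _ _) _; rewrite enc_natS.
by apply: RPair; constructor.
Qed.

Definition pmul (p q : prog) : prog :=
  PComp PSnd (PComp (ploop (padd PFst PSnd)) (PPair p (PPair q PNil))).

Lemma runs_mul p q x m n :
  runs p x (enc_nat K m) -> runs q x (enc_nat K n) ->
  runs (pmul p q) x (enc_nat K (m * n)).
Proof.
move=> pm qn; apply: RComp (runs_snd _ _).
apply: RComp; first by apply: RPair pm _; apply: RPair qn (RNil _).
rewrite mulnC -iter_addn_0.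
apply: (@runs_loop _ _ (addn n) m 0) => k; apply: runs_add.
  exact: runs_fst.
exact: runs_snd.
Qed.

Definition pexp (p q : prog) : prog :=
  PComp PSnd (PComp (ploop (pmul PFst PSnd)) (PPair q (PPair p (pconst 1)))).

Lemma runs_exp p q x m n :
  runs p x (enc_nat K m) -> runs q x (enc_nat K n) ->
  runs (pexp p q) x (enc_nat K (m ^ n)).
Proof.
move=> pm qn; apply: RComp (runs_snd _ _).
apply: RComp; first by apply: RPair qn _; apply: RPair pm (runs_pconst _ _).
have -> : (m ^ n = iter n (muln m) 1)%N by elim: n {qn} => //= n <-; rewrite expnS.
apply: runs_loop => k; apply: runs_mul.
  exact: runs_fst.
exact: runs_snd.
Qed.

(* The state of the loop is a stack of subtrees still to be visited, together
   with a counter. *)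
Definition psize : prog :=
  PComp PSnd (PComp
    (PWhile PFst
       (PPair (PIf (PComp PIsPair (PComp PFst PFst))
                 (PPair (PComp PFst (PComp PFst PFst))
                        (PPair (PComp PSnd (PComp PFst PFst))
                               (PComp PSnd PFst)))
                 (PComp PSnd PFst))
              (PComp psucc PSnd)))
    (PPair (PPair PId PNil) PNil)).

Lemma runs_size x : runs psize x (enc_nat K (tree_size x)).
Proof.
apply: RComp (runs_snd _ _).
apply: RComp; first by do 2![apply: RPair; last exact: RNil]; exact: RId.
(* Each round removes exactly one node from the stack, replacing a pair by its two subtrees, and
   increments the counter: the sum of both is invariant. *)
pose total s := sumn [seq tree_size y | y <- s].
have -> : Pair x Defs.Nil = enc_seq [:: x] by [].
rewrite -[tree_size x]addn0 -[(_ + 0)%N]/(total [:: x]) -[total _]addn0.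
change (@Defs.Nil K) with (enc_nat K 0) at 1; move: 0%N => c; move: [:: x] => {x} s.
have [k] := ubnP (total s); elim: k s c => // k IHk [|x s] c lt_k.
  exact: RWhileF (runs_fst _ _).
have succ_c st : runs (PComp psucc PSnd) (Pair st (enc_nat K c))
    (enc_nat K c.+1).
  by apply: RComp (runs_snd _ _) _; rewrite enc_natS; apply: RPair; constructor.
have fstfst (y st ct : tree K) : runs (PComp PFst PFst) (Pair (Pair y st) ct) y.
  exact: RComp (runs_fst _ _) (runs_fst _ _).
have sndfst (y st ct : tree K) : runs (PComp PSnd PFst) (Pair (Pair y st) ct) st.
  exact: RComp (runs_fst _ _) (runs_snd _ _).
have step (s' : seq (tree K)) :
  total (x :: s) = (total s').+1 ->
  runs (PIf (PComp PIsPair (PComp PFst PFst))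
         (PPair (PComp PFst (PComp PFst PFst))
            (PPair (PComp PSnd (PComp PFst PFst)) (PComp PSnd PFst)))
         (PComp PSnd PFst)) (Pair (enc_seq (x :: s)) (enc_nat K c))
    (enc_seq s') ->
  runs (PWhile PFst
       (PPair (PIf (PComp PIsPair (PComp PFst PFst))
                 (PPair (PComp PFst (PComp PFst PFst))
                        (PPair (PComp PSnd (PComp PFst PFst))
                               (PComp PSnd PFst)))
                 (PComp PSnd PFst))
              (PComp psucc PSnd)))
    (Pair (enc_seq (x :: s)) (enc_nat K c))
    (Pair Defs.Nil (enc_nat K (total (x :: s) + c))).
  move=> tE run; rewrite tE addSnnS.
  apply: RWhileT (runs_fst _ _) _ (RPair run (succ_c _)) _ => //.
  by apply: IHk; rewrite tE in lt_k.
case: x lt_k step => [|a|y z] lt_k step.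
- apply: (step s) => //; apply: RIfF (sndfst _ _ _).
  exact: RComp (fstfst _ _ _) (RIsPair _).
- apply: (step s) => //; apply: RIfF (sndfst _ _ _).
  exact: RComp (fstfst _ _ _) (RIsPair _).
apply: (step [:: y, z & s]).
  by rewrite /total /= addnA.
apply: RIfT; first exact: RComp (fstfst _ _ _) (RIsPair _).
  by [].
apply: RPair; first exact: RComp (fstfst _ _ _) (runs_fst _ _).
by apply: RPair (sndfst _ _ _); exact: RComp (fstfst _ _ _) (runs_snd _ _).
Qed.

End Computability.

(** * Heights *)

Lemma size_det_leq (K : fieldType) n (A : 'M[{poly K}]_n) D :
  (forall i j, (size (A i j) <= D.+1)%N) -> (size (\det A) <= (n * D).+1)%N.
Proof.
move=> sA; apply: (leq_trans (size_sum _ _ _)); apply/bigmax_leqP => s _.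
rewrite size_Msign; apply: (leq_trans (size_prod_leq _ _)).
rewrite card_ord leq_subLR; apply: (@leq_trans (\sum_(i < n) D.+1).+1).
  by rewrite ltnS; apply: leq_sum => i _; exact: sA.
by rewrite sum_nat_const card_ord mulnS addnS.
Qed.

(** The factorial counting the terms of a determinant is traded for a power, because the final bound
    has to be built from sums, products and powers. *)
Lemma fact_leq_expn n : (n`! <= n ^ n)%N.
Proof.
rewrite fact_prod big_nat_rev big_add1 /= big_mkord -[n in (_ ^ n)%N]card_ord.
by rewrite -prod_nat_const; apply: leq_prod => i _; lia.
Qed.

Section Height.
Variables (K : fieldType) (F : fieldExtType (ratfun K)).
Local Notation N := (\dim {:F}).
Local Notation B := (ff_basis F).
Local Notation tofrac := (@FracField.tofrac {poly K}).
Implicit Types (u v : F) (c : ratfun K).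

Lemma coord_ff_basis u : u = \sum_(i < N) coord B i u *: B`_i.
Proof. exact/coord_vbasis/memvf. Qed.

Lemma ff_basis_free : free B.
Proof. exact: basis_free (vbasisP _). Qed.

Lemma coord_ff_basis_nth (i j : 'I_N) : coord B j B`_i = (i == j)%:R.
Proof. by rewrite coord_free // ff_basis_free. Qed.

Definition mul_matrix u : 'M[ratfun K]_N := \matrix_(i, j) coord B j (u * B`_i).

Lemma mul_matrixD u v : mul_matrix (u + v) = mul_matrix u + mul_matrix v.
Proof. by apply/matrixP => i j; rewrite !mxE mulrDl linearD. Qed.

Lemma mul_matrixZ c u : mul_matrix (c *: u) = c *: mul_matrix u.
Proof. by apply/matrixP => i j; rewrite !mxE -scalerAl linearZ. Qed.

Lemma mul_matrix1 : mul_matrix 1 = 1%:M.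
Proof. by apply/matrixP => i j; rewrite !mxE mul1r coord_ff_basis_nth. Qed.

Lemma mul_matrixM u v : mul_matrix (u * v) = mul_matrix u *m mul_matrix v.
Proof.
(* Rows hold the images of the basis elements, which reverses products; commutativity of [F]
   restores the order. *)
apply/matrixP => i j; rewrite !mxE [u * v]mulrC -mulrA.
rewrite [X in v * X]coord_ff_basis mulr_sumr linear_sum; apply: eq_bigr => k _.
by rewrite !mxE -scalerAr linearZ.
Qed.

Lemma mul_matrixX u n : mul_matrix (u ^+ n) = iter n (mulmx (mul_matrix u)) 1%:M.
Proof.
by elim: n => [|n IHn]; rewrite ?expr0 ?mul_matrix1 // exprS mul_matrixM IHn.
Qed.

(* A substitute for the degree of the pole divisor of [u] that needs no places.
   It is subadditive for sums and products because the regular representation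
   is a ring morphism. *)
Definition height_le u D := exists (q : {poly K}) (A : 'M[{poly K}]_N),
  [/\ q != 0, tofrac q *: mul_matrix u = map_mx tofrac A,
      (size q <= D.+1)%N & forall i j, (size (A i j) <= D.+1)%N].

Lemma height_leW u D D' : height_le u D -> (D <= D')%N -> height_le u D'.
Proof.
move=> [q [A [q0 qA sq sA]]] leD; exists q, A; split=> // [|i j].
  exact: leq_trans sq _.
exact: leq_trans (sA i j) _.
Qed.

Lemma size_mulD (p q : {poly K}) D D' : (size p <= D.+1)%N ->
  (size q <= D'.+1)%N -> (size (p * q)%R <= (D + D').+1)%N.
Proof.
move=> sp sq; apply: leq_trans (size_polyMleq _ _) _.
by rewrite -subn1 leq_subLR add1n -addnS -addSn leq_add.
Qed.

Lemma size_sumD (I : finType) (p : I -> {poly K}) D :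
  (forall i, (size (p i) <= D.+1)%N) -> (size (\sum_i p i)%R <= D.+1)%N.
Proof.
by move=> sp; apply: leq_trans (size_sum _ _ _) _; apply/bigmax_leqP => i _.
Qed.

Lemma height_leD u v D D' : height_le u D -> height_le v D' ->
  height_le (u + v) (D + D').
Proof.
move=> [q [A [q0 qA sq sA]]] [q' [A' [q0' qA' sq' sA']]].
exists (q * q'), (q' *: A + q *: A'); split=> [||| i j].
- by rewrite mulf_neq0.
- rewrite mul_matrixD map_mxD !map_mxZ -qA -qA' scalerDr !scalerA tofracM.
  by rewrite [in X in X *: _ + _ = _]mulrC.
- exact: size_mulD.
rewrite !mxE; apply: leq_trans (size_polyD _ _) _.
rewrite geq_max [X in _ && X]size_mulD // andbT.
by rewrite addnC size_mulD.
Qed.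

Lemma height_leM u v D D' : height_le u D -> height_le v D' ->
  height_le (u * v) (D + D').
Proof.
move=> [q [A [q0 qA sq sA]]] [q' [A' [q0' qA' sq' sA']]].
exists (q * q'), (A *m A'); split=> [||| i j].
- by rewrite mulf_neq0.
- rewrite mul_matrixM map_mxM -qA -qA' -scalemxAl -scalemxAr scalerA.
  by rewrite tofracM.
- exact: size_mulD.
by rewrite mxE; apply: size_sumD => k; apply: size_mulD.
Qed.

Lemma height_le_alg (p q : {poly K}) D : q != 0 -> (size p <= D.+1)%N ->
  (size q <= D.+1)%N -> height_le (tofrac p / tofrac q)%:A D.
Proof.
move=> q0 sp sq; exists q, p%:M; split=> // [|i j].
  rewrite mul_matrixZ mul_matrix1 map_scalar_mx scalerA scalemx1 mulrC divfK //.
  by rewrite tofrac_eq0.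
by rewrite mxE; case: eqP; rewrite ?mulr1n // mulr0n size_poly0.
Qed.

Lemma height_le_const (a : K) : height_le (const_ff F a) 0.
Proof.
rewrite /const_ff -[tofrac _]divr1 -tofrac1; apply: height_le_alg.
- exact: oner_neq0.
- exact: size_polyC_leq1.
by rewrite size_poly1.
Qed.

Lemma const_ff_is_zmod_morphism : zmod_morphism (const_ff F).
Proof. by move=> a b; rewrite /const_ff polyCB tofracB scalerBl. Qed.

Lemma const_ff_is_monoid_morphism : monoid_morphism (const_ff F).
Proof.
split=> [|a b]; first by rewrite /const_ff tofrac1 scale1r.
by rewrite /const_ff polyCM tofracM [RHS]mulr_algl scalerA.
Qed.

HB.instance Definition _ :=
  GRing.isZmodMorphism.Build K F (const_ff F) const_ff_is_zmod_morphism.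
HB.instance Definition _ :=
  GRing.isMonoidMorphism.Build K F (const_ff F) const_ff_is_monoid_morphism.

Lemma height_leMn u D n : height_le u D -> height_le (u *+ n) D.
Proof.
move=> hu; rewrite -mulr_natr -(rmorph_nat (const_ff F)) -[D]addn0.
exact/height_leM/height_le_const.
Qed.

Lemma height_leN u D : height_le u D -> height_le (- u) D.
Proof.
move=> hu; rewrite -mulrN1 -(rmorphN1 (const_ff F)) -[D]addn0.
exact/height_leM/height_le_const.
Qed.

Lemma height_leX u D n : height_le u D -> height_le (u ^+ n) (n * D).
Proof.
move=> hu; elim: n => [|n IHn].
  by rewrite expr0 -(rmorph1 (const_ff F)); exact: height_le_const.
by rewrite exprS mulSn; exact: height_leM.
Qed.

Lemma height_le_sum (I : finType) (u : I -> F) D :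
  (forall i, height_le (u i) D) -> height_le (\sum_i u i) (#|I| * D).
Proof.
move=> hu; rewrite cardE -big_enum; elim: (enum I) => [|i s IHs].
  by rewrite big_nil -(rmorph0 (const_ff F)); exact: height_le_const.
by rewrite big_cons mulSn; apply: height_leD.
Qed.

Lemma height_le_prod (I : finType) (u : I -> F) D :
  (forall i, height_le (u i) D) -> height_le (\prod_i u i) (#|I| * D).
Proof.
move=> hu; rewrite cardE -big_enum; elim: (enum I) => [|i s IHs].
  by rewrite big_nil -(rmorph1 (const_ff F)); exact: height_le_const.
by rewrite big_cons mulSn; apply: height_leM.
Qed.

(** If [q] times the matrix M of [u] is [A], then M^-1 = q adj A / det A, where det A has degree at
    most N D and q adj A at most D + (N - 1) D. *)
Lemma height_leV u D : height_le u D -> height_le u^-1 (N * D).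
Proof.
have [->|u0] := eqVneq u 0.
  by rewrite invr0 -(rmorph0 (const_ff F)) => _; apply: height_leW (height_le_const _) _.
move=> [q [A [q0 qA sq sA]]].
have VM : mul_matrix u^-1 *m map_mx tofrac A = (tofrac q)%:M.
  by rewrite -qA -scalemxAr -mul_matrixM mulVf // mul_matrix1 scalemx1.
have dA : \det A != 0.
  have : \det (mul_matrix u^-1 *m map_mx tofrac A) != 0.
    by rewrite VM det_scalar expf_neq0 // tofrac_eq0.
  by rewrite det_mulmx det_map_mx mulf_eq0 negb_or tofrac_eq0 => /andP[].
have N_gt0 : (0 < N)%N by rewrite adim_gt0.
exists (\det A), (q *: \adj A); split=> // [||i j].
- rewrite map_mxZ map_mx_adj -[RHS]mul_scalar_mx -VM -mulmxA mul_mx_adj det_map_mx.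
  by rewrite mul_mx_scalar.
- exact: size_det_leq.
have -> : (N * D = D + N.-1 * D)%N by rewrite -mulSn prednK.
rewrite !mxE /cofactor size_mulD // size_Msign.
by apply: size_det_leq => k l; rewrite !mxE.
Qed.

Lemma height_leVf u v D D' : height_le u D -> height_le v D' ->
  height_le (u / v) (D + N * D').
Proof. by move=> hu hv; apply/height_leM/height_leV. Qed.

Lemma height_le_mul_matrix u D i j : height_le u D ->
  height_le (mul_matrix u i j)%:A D.
Proof.
move=> [q [A [q0 qA sq sA]]].
suff -> : mul_matrix u i j = tofrac (A i j) / tofrac q by apply: height_le_alg.
have /matrixP/(_ i j) := qA; rewrite !mxE => <-.
by rewrite [RHS]mulrC mulKf // tofrac_eq0.
Qed.

(** The matrix of a scalar is scalar, so a diagonal entry of [A] divided by [q] is the scalar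
    itself. *)
Lemma height_le_fracP c D : height_le c%:A D ->
  exists p q : {poly K}, [/\ q != 0, (size p <= D.+1)%N, (size q <= D.+1)%N
                & c = tofrac p / tofrac q].
Proof.
move=> [q [A [q0 qA sq sA]]]; pose i := Ordinal (adim_gt0 {:F}%AS).
exists (A i i), q; split=> //.
have /matrixP/(_ i i) := qA; rewrite mul_matrixZ mul_matrix1 !mxE eqxx mulr1 => <-.
by rewrite [RHS]mulrC mulKf // tofrac_eq0.
Qed.

(** The coordinate is the entry (i, j) of the matrix of [u / B_i], whatever [i] is. *)
Lemma height_le_coord u D (i j : 'I_N) D' : height_le u D ->
  height_le B`_i D' -> height_le (coord B j u)%:A (D + N * D').
Proof.
move=> hu hB; rewrite -[u](@divfK _ B`_i).
  have := @height_le_mul_matrix (u / B`_i) (D + N * D') i j (height_leVf hu hB).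
  by rewrite mxE.
have := free_not0 ff_basis_free.
by move=> ->; first by []; rewrite mem_nth // size_tuple.
Qed.

Lemma height_le_det n (A : 'M[F]_n) D : (forall i j, height_le (A i j) D) ->
  height_le (\det A) (n ^ n * (n * D)).
Proof.
move=> hA; apply: (@height_leW _ (n`! * (n * D))); last first.
  by rewrite leq_mul2r fact_leq_expn ?orbT.
rewrite -card_Sn; apply: height_le_sum => s; rewrite -signr_odd mulr_sign.
have hP : height_le (\prod_i A i (s i)) (n * D).
  by rewrite -[n in (n * D)%N]card_ord; exact: height_le_prod.
by case: odd => //; exact: height_leN.
Qed.

(** Each entry is a cofactor over the determinant; dividing by an element multiplies its height by
    N. *)
Lemma height_le_invmx n (A : 'M[F]_n) D i j : A \in unitmx ->
  (forall i j, height_le (A i j) D) ->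
  height_le (invmx A i j) ((N.+1) * (n ^ n * (n * D))).
Proof.
move=> uA hA; rewrite /invmx uA !mxE mulrC mulSn; apply: height_leVf.
  rewrite /cofactor -signr_odd mulr_sign.
  case: n A i j hA {uA} => [|n] A i j hA; first by case: i.
  have hC : height_le (\det (row' j (col' i A))) (n ^ n * (n * D)).
    by apply: height_le_det => k l; rewrite !mxE.
  apply: (@height_leW _ (n ^ n * (n * D))).
    by case: odd => //; exact: height_leN.
  rewrite leq_mul // ?leq_mul //; apply: (@leq_trans (n.+1 ^ n)).
    by case: n {A i j hA hC} => // n; rewrite leq_exp2r.
  by rewrite leq_pexp2l.
exact: height_le_det.
Qed.

End Height.

(** * The derivation d/dx *)

Lemma quotient_rule_mul (L : fieldType) (a a' b b' c c' d d' : L) :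
  b != 0 -> d != 0 ->
  ((a' * c + a * c') * (b * d) - a * c * (b' * d + b * d')) / (b * d) ^+ 2 =
  (a' * b - a * b') / b ^+ 2 * (c / d) + a / b * ((c' * d - c * d') / d ^+ 2).
Proof. by move=> b0 d0; field; rewrite b0 d0. Qed.

Lemma quotient_rule_add (L : fieldType) (a a' b b' c c' d d' : L) :
  b != 0 -> d != 0 ->
  ((a' * d + a * d' + (c' * b + c * b')) * (b * d)
    - (a * d + c * b) * (b' * d + b * d')) / (b * d) ^+ 2 =
  (a' * b - a * b') / b ^+ 2 + (c' * d - c * d') / d ^+ 2.
Proof. by move=> b0 d0; field; rewrite b0 d0. Qed.

Section FracDerivation.
Variable K : fieldType.
Local Notation tofrac := (@FracField.tofrac {poly K}).
Implicit Types (p q : {poly K}) (r s : ratfun K).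

Definition dfrac r : ratfun K :=
  tofrac ((frac_num r)^`() * frac_den r - frac_num r * (frac_den r)^`()) /
  tofrac (frac_den r) ^+ 2.

Lemma fracP r : exists p q, q != 0 /\ r = tofrac p / tofrac q.
Proof.
have [rE _ /monic_neq0 q0] := frac_num_den r.
by exists (frac_num r), (frac_den r).
Qed.

(** The quotient rule gives the same value on every representation, so the derivation rules can be
    checked without reducing to lowest terms. *)
Lemma dfracE p q : q != 0 ->
  dfrac (tofrac p / tofrac q) = tofrac (p^`() * q - p * q^`()) / tofrac q ^+ 2.
Proof.
move=> q0; rewrite /dfrac; set r := tofrac p / _.
have [rE _ /monic_neq0 d0] := frac_num_den r.
move: (frac_num r) (frac_den r) rE d0 => n d; rewrite {}/r => rE d0.
have tq0 : tofrac q != 0 by rewrite tofrac_eq0.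
have td0 : tofrac d != 0 by rewrite tofrac_eq0.
have E1 : n * q = p * d.
  apply/eqP; rewrite -tofrac_eq eq_sym.
  rewrite !tofracM -(eqr_div _ _ tq0 td0).
  exact/eqP.
have E2 : n^`() * q + n * q^`() = p^`() * d + p * d^`() by rewrite -!derivM E1.
apply/eqP; rewrite (eqr_div _ _ (expf_neq0 2 td0) (expf_neq0 2 tq0)).
rewrite -!tofracXn -!tofracM; apply/eqP.
congr (tofrac _); apply/eqP; rewrite -subr_eq0.
(* The cross-multiplied difference is a combination of n q - p d and of its derivative, which both
   vanish. *)
have -> : (n^`() * d - n * d^`()) * q ^+ 2 - (p^`() * q - p * q^`()) * d ^+ 2
  = d * q * ((n^`() * q + n * q^`()) - (p^`() * d + p * d^`()))
    - (d^`() * q + d * q^`()) * (n * q - p * d) by ring.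
by rewrite E1 E2 !subrr !mulr0 subrr.
Qed.

Lemma dfrac_tofrac p : dfrac (tofrac p) = tofrac p^`().
Proof.
rewrite -[tofrac p]divr1 -[1]tofrac1 dfracE ?oner_neq0 //.
by rewrite derivC mulr0 subr0 mulr1 tofrac1 expr1n divr1.
Qed.

Lemma dfracM r s : dfrac (r * s) = dfrac r * s + r * dfrac s.
Proof.
have [p [q [q0 ->]]] := fracP r; have [p' [q' [q0' ->]]] := fracP s.
have tq0 : tofrac q != 0 by rewrite tofrac_eq0.
have tq0' : tofrac q' != 0 by rewrite tofrac_eq0.
rewrite mulf_div -!tofracM !dfracE ?mulf_neq0 // !derivM.
by rewrite !tofracB !tofracM !tofracD !tofracM (quotient_rule_mul _ _ _ _ _ _ tq0 tq0').
Qed.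

Lemma dfracD r s : dfrac (r + s) = dfrac r + dfrac s.
Proof.
have [p [q [q0 ->]]] := fracP r; have [p' [q' [q0' ->]]] := fracP s.
have tq0 : tofrac q != 0 by rewrite tofrac_eq0.
have tq0' : tofrac q' != 0 by rewrite tofrac_eq0.
rewrite (addf_div _ _ tq0 tq0') -!tofracM -tofracD !dfracE ?mulf_neq0 //.
rewrite derivD !derivM !tofracB !tofracM !tofracD !tofracM.
by rewrite (quotient_rule_add _ _ _ _ _ _ tq0 tq0').
Qed.

Lemma dfrac_is_zmod_morphism : zmod_morphism dfrac.
Proof.
have d0 : dfrac 0 = 0 by rewrite -tofrac0 dfrac_tofrac derivC tofrac0.
move=> r s; apply/eqP; rewrite eq_sym subr_eq -[X in dfrac X](subrK s).
by rewrite dfracD.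
Qed.

HB.instance Definition _ :=
  GRing.isZmodMorphism.Build (ratfun K) (ratfun K) dfrac dfrac_is_zmod_morphism.

(** For n / d in lowest terms, n' d = n d' shows that d divides d'. By degree d' = 0, so in
    characteristic 0 the monic d is 1, and then n' = 0. *)
Lemma dfrac_eq0 r : [pchar K] =i pred0 -> dfrac r = 0 ->
  exists a : K, r = tofrac a%:P.
Proof.
move=> char0; have [rE cop mon] := frac_num_den r.
rewrite {1}rE dfracE ?monic_neq0 // => /eqP.
rewrite mulf_eq0 invr_eq0 expf_eq0 /= !tofrac_eq0 (negPf (monic_neq0 mon)) orbF.
rewrite subr_eq0 => /eqP E.
have der0 (p : {poly K}) : p^`() = 0 -> exists a, p = a%:P.
  move=> p'0; exists p`_0; apply/size1_polyC; rewrite leqNgt; apply/negP => sp.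
  have /polyP/(_ (size p).-2)/eqP := p'0.
  rewrite coef_deriv coef0 -mulr_natr mulf_eq0 ((pcharf0P K).1 char0) orbF.
  have -> : (size p).-2.+1 = (size p).-1 by case: (size p) sp => [|[]].
  by rewrite -/(lead_coef p) lead_coef_eq0 -size_poly_eq0 => /eqP p0; rewrite p0 in sp.
have : frac_den r %| (frac_den r)^`().
  rewrite -(@Gauss_dvdpr _ _ (frac_num r)) 1?coprimep_sym //.
  by rewrite -E dvdp_mulIr.
move=> dvd; have [b bE] : exists b, frac_den r = b%:P.
  apply: der0; apply/eqP/negPn/negP => nz; have := dvdp_leq nz dvd.
  by rewrite leqNgt lt_size_deriv ?monic_neq0.
have b1 : b = 1 by move: mon; rewrite bE monicE lead_coefC => /eqP.
have [a aE] : exists a, frac_num r = a%:P.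
  by apply: der0; move: E; rewrite bE b1 derivC mulr0 mulr1.
by exists a; rewrite {1}rE bE aE b1 tofrac1 divr1.
Qed.

End FracDerivation.

(** * Extending d/dx from K(x) to F *)

Section Derivation.
Variables (K : fieldType) (F : fieldExtType (ratfun K)).
Hypothesis char0 : [pchar K] =i pred0.

Definition derivation (D : F -> F) := [/\ zmod_morphism D,
  forall u v, D (u * v) = D u * v + u * D v & forall c, D c%:A = (dfrac c)%:A].

Lemma pchar_ff : [pchar F] =i pred0.
Proof.
move=> p; rewrite inE /= -(rmorph_nat (const_ff F)) fmorph_eq0.
by have := char0 p; rewrite inE.
Qed.

Lemma horner_algEmap (u : F) p : horner_alg u p = (map_poly (in_alg F) p).[u].
Proof. by []. Qed.

(** The minimal polynomial over K(x) is pulled back to coefficients in K(x). Separability makes the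
    value of its derivative at [u] invertible, which allows solving for [D u]. *)
Lemma minPoly1P (u : F) : exists m : {poly ratfun K},
  [/\ minPoly 1 u = map_poly (in_alg F) m, m \is monic,
      (size m <= (\dim {:F}).+1)%N, horner_alg u m = 0
    & horner_alg u m^`() != 0].
Proof.
have /polyOver1P[m mE] := minPolyOver 1 u; exists m; split=> //.
- by rewrite -(map_monic (in_alg F)) -mE monic_minPoly.
- rewrite -(size_map_poly (in_alg F)) -mE size_minPoly ltnS.
  rewrite /adjoin_degree dim_vline oner_eq0 divn1 prednK; first exact/dimvS/subvf.
  exact: adim_gt0.
- by rewrite horner_algEmap -mE; exact/eqP/root_minPoly.
have := separable_root_der 1 u; rewrite pcharf0_separable; last exact: pchar_ff.
by rewrite mE deriv_map.
Qed.

(** By the primitive element theorem F is generated by [th]. Let [dp] differentiate coefficients.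
    The map sending p to dp p (th) + p'(th) eta obeys the product rule, and it depends only on p(th)
    as soon as it kills the minimal polynomial m of [th]. This forces eta = - dp m (th) / m'(th). *)
Lemma derivation_exists : exists D, derivation D.
Proof.
pose th := separable_generator 1 {:F}.
have thE : {:F}%VS = <<1; th>>%VS.
  apply: eq_adjoin_separable_generator; last exact: subvf.
  by apply/separableP => y _; apply/pcharf0_separable/pchar_ff.
pose ev := horner_alg th.
have rep (u : F) : exists p, u = ev p.
  have /polyOver1P[p pE] := Fadjoin_polyOver 1 th u; exists p.
  by rewrite /ev horner_algEmap -pE Fadjoin_poly_eq // -thE memvf.
have [m [mE _ _ evm evm']] := minPoly1P th.
have ker p : ev p = 0 -> exists q, p = q * m.
  move=> /eqP evp; apply/dvdpP; rewrite -(dvdp_map (in_alg F)) -mE.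
  by apply: minPoly_dvdp => //; apply/polyOver1P; exists p.
pose dp := map_poly (@dfrac K).
have dpM p q : dp (p * q) = dp p * q + p * dp q.
  apply/polyP => i; rewrite coefD !coefM coef_map coefM raddf_sum -big_split.
  by apply: eq_bigr => j _; rewrite /= dfracM !coef_map.
pose eta := - ev (dp m) / ev m^`().
pose Phi p := ev (dp p) + ev p^`() * eta.
have PhiB p q : Phi (p - q) = Phi p - Phi q.
  by rewrite /Phi /dp raddfB derivB /ev !rmorphB /=; ring.
have PhiM p q : Phi (p * q) = Phi p * ev q + ev p * Phi q.
  by rewrite /Phi dpM derivM /ev !rmorphD !rmorphM; ring.
have Phim : Phi m = 0 by rewrite /Phi /eta mulrC divfK // subrr.
have Phi_wd p q : ev p = ev q -> Phi p = Phi q.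
  move=> epq; have [|r rE] := ker (p - q).
    by rewrite [ev _]rmorphB; apply/eqP; rewrite subr_eq0; apply/eqP.
  by apply/eqP; rewrite -subr_eq0 -PhiB rE PhiM Phim [ev m]evm !mulr0 addr0.
have [rp rpE] := choice rep.
exists (fun u => Phi (rp u)); split=> [u v|u v|c].
- by rewrite -PhiB; apply: Phi_wd; rewrite -rpE {1}(rpE u) {1}(rpE v) /ev rmorphB.
- rewrite {2}(rpE v) {3}(rpE u) -PhiM; apply: Phi_wd.
  by rewrite -rpE {1}(rpE u) {1}(rpE v) /ev rmorphM.
have <- : Phi c%:P = (dfrac c)%:A.
  rewrite /Phi derivC [ev 0]rmorph0 mul0r addr0 [dp _]map_polyC.
  exact: horner_algC.
by apply: Phi_wd; rewrite -rpE /ev horner_algC.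
Qed.

End Derivation.

Lemma map_poly_XaddC (A B : nzRingType) (f : {additive A -> B}) p c :
  map_poly f (p * 'X + c%:P) = map_poly f p * 'X + (f c)%:P.
Proof.
apply/polyP=> i; rewrite !(coef_map, coefD, coefMX, coefC) raddfD.
by case: eqP => _ /=; rewrite ?raddf0.
Qed.

Lemma horner_algE (L : fieldType) (E : fieldExtType L) (u : E) (p : {poly L}) :
  horner_alg u p = \sum_(i < size p) p`_i *: u ^+ i.
Proof.
rewrite -[LHS]/((map_poly (in_alg E) p).[u]) horner_coef size_map_poly.
by apply: eq_bigr => i _; rewrite coef_map /= mulr_algl.
Qed.

Lemma leibniz_horner (L : fieldType) (E : fieldExtType L)
    (d : {additive L -> L}) (D : E -> E) :
  (forall u v, D (u + v) = D u + D v) ->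
  (forall u v, D (u * v) = D u * v + u * D v) ->
  (forall c, D c%:A = (d c)%:A) ->
  forall (u : E) (p : {poly L}),
  D (horner_alg u p) = horner_alg u (map_poly d p) + horner_alg u p^`() * D u.
Proof.
move=> DD DM DZ u.
have D0 : D 0 = 0.
  by have /eqP := DD 0 0; rewrite addr0 addrC -subr_eq subrr => /eqP.
elim/poly_ind => [|p c IHp]; first by rewrite !raddf0 D0 mul0r addr0.
rewrite map_poly_XaddC derivD derivM derivX derivC addr0 mulr1.
rewrite !rmorphD !rmorphM /= !horner_algX !horner_algC DD DM DZ IHp.
rewrite !mulrDl [_ * D u * u]mulrAC [RHS]addrAC -!addrA; congr (_ + _).
Qed.

Lemma size_deriv_leq (R : nzRingType) (p : {poly R}) : (size p^`() <= size p)%N.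
Proof. by have [->|/lt_size_deriv/ltnW] := eqVneq p 0; rewrite ?deriv0. Qed.

Lemma alg_mul (L : fieldType) (E : fieldExtType L) (a b : L) :
  (a * b)%:A = a%:A * b%:A :> E.
Proof. by rewrite mulr_algl scalerA. Qed.

Lemma horner_alg_wide (L : fieldType) (E : fieldExtType L) (u : E) (p : {poly L}) n :
  (size p <= n)%N -> horner_alg u p = \sum_(i < n) p`_i *: u ^+ i.
Proof.
move=> sp; rewrite -[LHS]/((map_poly (in_alg E) p).[u]).
rewrite (@horner_coef_wide _ n) ?size_map_poly //.
by apply: eq_bigr => i _; rewrite coef_map /= mulr_algl.
Qed.

(* The powers of [u] below the degree of its minimal polynomial are linearly
   independent, so a nonsingular square submatrix of their coordinates
   determines the coefficients of that polynomial. *)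
Lemma minPoly_coefs (L : fieldType) (E : fieldExtType L) n (X : n.-tuple E)
    (u : E) (m : {poly L}) (r := (size m).-1) :
  basis_of {:E} X -> minPoly 1 u = map_poly (in_alg E) m -> m \is monic ->
  exists f : 'I_r -> 'I_n,
  let Q := \matrix_(k < r, j < r) coord X (f k) (u ^+ j) in
  Q \in unitmx /\
  forall j : 'I_r, m`_j = - (invmx Q *m \col_k coord X (f k) (u ^+ r)) j 0.
Proof.
move=> bX mE mon.
have m_gt0 : (0 < size m)%N by rewrite size_poly_gt0 monic_neq0.
have evm : horner_alg u m = 0.
  rewrite -[LHS]/((map_poly (in_alg E) m).[u]) -mE; exact/eqP/root_minPoly.
pose P := \matrix_(k < r, j < n) coord X j (u ^+ k).
(* A dependency between the rows is a polynomial of degree below that of [m] vanishing at [u]. *)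
have freeP : row_free P.
  rewrite -kermx_eq0; apply/rowV0P => c /sub_kermxP cP0.
  have sc : (size (rVpoly c) <= r)%N by exact: size_poly.
  have : root (map_poly (in_alg E) (rVpoly c)) u.
    rewrite rootE -[_.[u]]/(horner_alg u _) (horner_alg_wide _ sc); apply/eqP.
    rewrite [LHS](coord_basis bX) ?memvf //; apply: big1 => j _.
    have /rowP/(_ j) := cP0; rewrite !mxE => c0.
    rewrite linear_sum (_ : \sum_i _ = 0) ?scale0r // -[RHS]c0.
    by apply: eq_bigr => k _; rewrite linearZ coef_rVpoly_ord !mxE.
  move=> /minPoly_dvdp => /(_ 1%AS) dvd.
  have {dvd} : minPoly 1 u %| map_poly (in_alg E) (rVpoly c).
    by apply: dvd; apply/polyOver1P; exists (rVpoly c).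
  rewrite mE dvdp_map => dvd; rewrite -[c]rVpolyK.
  suff -> : rVpoly c = 0 by rewrite linear0.
  apply/eqP/negPn/negP => nz; have := dvdp_leq nz dvd.
  by rewrite leqNgt (leq_ltn_trans sc) // /r ltn_predL.
have fullP : row_full P^T by rewrite /row_full mxrank_tr.
pose f := fullrankfun fullP; exists f; set Q := \matrix_(k, j) _.
have QE : Q = rowsub f P^T by apply/matrixP => k j; rewrite !mxE.
have uQ : Q \in unitmx by rewrite QE fullrowsub_unit.
split=> // j; set b := \col_k _.
(* The equation m(u) = 0, read in the selected coordinates with the leading term moved to one side,
   is this linear system. *)
have Qc : Q *m \col_(k < r) (- m`_k) = b.
  apply/colP => k; rewrite !mxE.
  have sm : (size m <= r.+1)%N by rewrite /r prednK.
  move: evm; rewrite (horner_alg_wide _ sm) big_ord_recr /=.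
  rewrite -/(lead_coef m) (monicP mon) scale1r => /eqP.
  rewrite addrC addr_eq0 => /eqP ->; rewrite linearN linear_sum -sumrN.
  by apply: eq_bigr => i _; rewrite !mxE linearZ mulrN mulrC.
by rewrite -Qc mulKmx // mxE opprK.
Qed.

Section DerivationConstants.
Variables (K : closedFieldType) (F : fieldExtType (ratfun K)).
Hypothesis char0 : [pchar K] =i pred0.
Variables (D : F -> F) (derD : derivation D).

(** Over the algebraically closed K the polynomial splits, so [u] is one of its roots in K: K is
    algebraically closed in F. *)
Lemma root_is_const (p : {poly K}) (u : F) :
  p != 0 -> (map_poly (const_ff F) p).[u] = 0 -> is_const u.
Proof.
move=> p0; have [rs ->] := closed_field_poly_normal p.
rewrite map_polyZ rmorph_prod /= hornerZ horner_prod => /eqP.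
rewrite mulf_eq0 fmorph_eq0 lead_coef_eq0 (negPf p0) /=.
rewrite prodf_seq_eq0 => /hasP[a _] /=.
rewrite map_polyXsubC hornerXsubC subr_eq0 => /eqP ->.
by exists a.
Qed.

Lemma derivation0 : D 0 = 0.
Proof. by have [zD _ _] := derD; rewrite -[X in D X](subrr 0) zD subrr. Qed.

Lemma derivationN u : D (- u) = - D u.
Proof. by have [zD _ _] := derD; rewrite -[- u]sub0r zD derivation0 sub0r. Qed.

Lemma derivationD u v : D (u + v) = D u + D v.
Proof.
have [zD _ _] := derD.
by rewrite -[v in LHS]opprK zD derivationN opprK.
Qed.

Lemma derivation_sum (I : finType) (u : I -> F) : D (\sum_i u i) = \sum_i D (u i).
Proof. exact: (big_morph D derivationD derivation0). Qed.

Lemma derivation_const a : D (const_ff F a) = 0.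
Proof.
have [_ _ DZ] := derD.
by rewrite /const_ff DZ dfrac_tofrac derivC tofrac0 scale0r.
Qed.

Lemma derivation_constM a u : D (const_ff F a * u) = const_ff F a * D u.
Proof.
by have [_ DM _] := derD; rewrite DM derivation_const mul0r add0r.
Qed.

Lemma derivation_horner (u : F) (p : {poly ratfun K}) :
  D (horner_alg u p) =
  horner_alg u (map_poly (@dfrac K) p) + horner_alg u p^`() * D u.
Proof.
have [_ DM DZ] := derD.
exact: (@leibniz_horner _ _ (@dfrac K) D derivationD DM DZ).
Qed.

(** Differentiating m(u) = 0 with D u = 0 shows that the polynomial with differentiated coefficients
    kills [u]. As [m] is monic, this polynomial has smaller degree, hence is 0. So [m] has
    coefficients in K, and [u] is algebraic over K. *)
Lemma derivation_eq0 u : D u = 0 -> is_const u.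
Proof.
move=> Du0; have [m [mE mon sm evm _]] := minPoly1P char0 u.
have dm0 : map_poly (@dfrac K) m = 0.
  have : horner_alg u (map_poly (@dfrac K) m) = 0.
    have := derivation_horner u m.
    by rewrite evm derivation0 Du0 mulr0 addr0 => <-.
  move=> /eqP ev0; apply/eqP; rewrite -(map_poly_eq0 (in_alg F)).
  have /minPoly_dvdp/(_ ev0) : map_poly (in_alg F) (map_poly (@dfrac K) m)
      \is a polyOver 1%VS by apply/polyOver1P; eexists.
  rewrite mE; apply: contraTT => nz.
  rewrite gtNdvdp // !size_map_poly.
  have m_gt0 : (0 < size m)%N by rewrite size_poly_gt0 monic_neq0.
  rewrite -(prednK m_gt0) ltnS; apply/leq_sizeP => j le_j.
  rewrite coef_map /=; have [lt_j|ltj] := ltnP j (size m).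
    have -> : j = (size m).-1 by lia.
    rewrite -/(lead_coef m) (monicP mon) -[1]tofrac1 dfrac_tofrac.
    by rewrite derivC tofrac0.
  by rewrite nth_default // raddf0.
have coefm i : exists a, m`_i = FracField.tofrac a%:P.
  apply: dfrac_eq0 => //.
  by rewrite -[LHS](coef_map (@dfrac K)) dm0 coef0.
have [a aE] := choice coefm.
pose m0 := \poly_(i < size m) a i.
have mm0 : map_poly (in_alg F) m = map_poly (const_ff F) m0.
  apply/polyP => i; rewrite !coef_map coef_poly /= aE.
  case: ltnP => // le_i.
  by rewrite rmorph0 -aE nth_default // scale0r.
apply: (@root_is_const m0); last by rewrite -mm0 -horner_algEmap.
by rewrite -(map_poly_eq0 (const_ff F)) -mm0 map_poly_eq0 monic_neq0.
Qed.

End DerivationConstants.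

(** * Heights of derivatives *)

Section DerivationHeight.
Variables (K : closedFieldType) (F : fieldExtType (ratfun K)).
Hypothesis char0 : [pchar K] =i pred0.
Variables (S H : nat).
Local Notation N := (\dim {:F}).
Local Notation B := (ff_basis F).
Hypothesis leNS : (N <= S)%N.
Hypothesis leBH : forall i : 'I_N, height_le B`_i H.

Lemma height_le_dfrac (c : ratfun K) M : height_le (c%:A : F) M ->
  height_le ((dfrac c)%:A : F) (M + M).
Proof.
move=> /height_le_fracP[p [q [q0 sp sq ->]]]; rewrite dfracE // -tofracXn.
have sder (r : {poly K}) : (size r <= M.+1)%N -> (size r^`() <= M.+1)%N.
  by apply: leq_trans; exact: size_deriv_leq.
apply: height_le_alg; rewrite ?expf_neq0 //; last by rewrite expr2 size_mulD.
rewrite (leq_trans (size_polyD _ _)) // size_polyN geq_max.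
by rewrite !size_mulD ?sder.
Qed.

Lemma height_le_horner (p : {poly ratfun K}) (u : F) (T M D0 : nat) :
  (size p <= T.+1)%N -> (forall i, height_le ((p`_i)%:A : F) M) ->
  height_le u D0 -> height_le (horner_alg u p) (T.+1 * (M + T * D0)).
Proof.
move=> sp hp hu; rewrite horner_algE.
apply: height_leW (leq_mul sp (leqnn _)).
rewrite -[X in (X * _)%N]card_ord; apply: height_le_sum => i.
rewrite -mulr_algl; apply: height_leM => //.
apply: height_leW (height_leX i hu) _.
by rewrite leq_mul // -ltnS (leq_trans (ltn_ord i)).
Qed.

(** Cramer's rule for the system of [minPoly_coefs]: at most S products of an entry of the inverse
    matrix and a coordinate of a power, the coordinates having height at most S (D0 + H). *)
Definition minpoly_factor := (S * (S.+1 * (S ^ S * (S * S)) + S))%N.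

Lemma height_le_minPoly (u : F) D0 m i :
  minPoly 1 u = map_poly (in_alg F) m -> m \is monic ->
  (size m <= N.+1)%N -> horner_alg u m = 0 -> height_le u D0 ->
  height_le ((m`_i)%:A : F) (minpoly_factor * (D0 + H)).
Proof.
move=> mE mon sm evm hu; pose r := (size m).-1.
have m_gt0 : (0 < size m)%N by rewrite size_poly_gt0 monic_neq0.
have leri : (r <= N)%N by rewrite -ltnS prednK.
have lerS : (r <= S)%N := leq_trans leri leNS.
pose E := (S * (D0 + H))%N.
have N_gt0 : (0 < N)%N by rewrite adim_gt0.
have S_gt0 : (0 < S)%N := leq_trans N_gt0 leNS.
pose i0 := Ordinal N_gt0.
have hcoord k (j : 'I_N) : (k <= r)%N ->
    height_le ((coord B j (u ^+ k))%:A : F) E.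
  move=> lekr; apply: height_leW (height_le_coord j (height_leX k hu) (leBH i0)) _.
  by rewrite /E mulnDr leq_add // leq_mul2r ?leNS ?(leq_trans lekr) ?orbT.
have [lt_i|le_i] := ltnP i r; last first.
  have [->|lt_i] := eqVneq i r.
    rewrite -/(lead_coef m) (monicP mon) scale1r -(rmorph1 (const_ff F)).
    exact: height_leW (height_le_const _ _) _.
  rewrite nth_default ?scale0r -?(rmorph0 (const_ff F)).
    exact: height_leW (height_le_const _ _) _.
  by rewrite -(prednK m_gt0) ltn_neqAle eq_sym lt_i.
have [f [uQ mQ]] := minPoly_coefs (vbasisP {:F}) mE mon.
set Q := \matrix_(k, j) _ in uQ mQ.
rewrite (mQ (Ordinal lt_i)) scaleNr; apply: height_leN.
rewrite mxE scaler_suml; set i' := Ordinal lt_i.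
have hQ k : height_le ((invmx Q i' k)%:A : F) (N.+1 * (r ^ r * (r * E))).
  have -> : (invmx Q i' k)%:A = invmx (map_mx (in_alg F) Q) i' k.
    by rewrite -map_invmx mxE.
  apply: height_le_invmx => [|k' l]; first by rewrite map_unitmx.
  by rewrite !mxE; apply: hcoord; exact: ltnW.
apply: (@height_leW _ _ _ (r * (N.+1 * (r ^ r * (r * E)) + E))).
  rewrite -[X in (X * _)%N](card_ord r); apply: height_le_sum => k.
  rewrite mxE (_ : (_ * _)%:A = (invmx Q i' k)%:A * (coord B (f k) (u ^+ r))%:A).
    by apply: height_leM (hQ k) (hcoord _ _ _).
  exact: alg_mul.
rewrite /minpoly_factor -mulnA mulnDl -!mulnA -/E.
apply: leq_mul => //; rewrite leq_add2r; apply: leq_mul => //.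
apply: leq_mul; last exact: leq_mul.
by apply: leq_trans (leq_pexp2l S_gt0 lerS); case: (r) lerS => // r' ?; rewrite leq_exp2r.
Qed.

(** The outer [S.+1] pays for the division by m'(u), the inner one for the number of summands in the
    values at [u]. *)
Definition derivation_factor := (S.+1 * (S.+1 * (2 * minpoly_factor + S)))%N.

(** Differentiating m(u) = 0 expresses D u as minus a quotient of two values at [u]: that of [m]
    with differentiated coefficients and that of m'. Bounds for the coefficients of [m] therefore
    suffice. *)
Lemma height_le_derivation (D : F -> F) u D0 : derivation D -> height_le u D0 ->
  height_le (D u) (derivation_factor * (D0 + H)).
Proof.
move=> derD hu; have [m [mE mon sm evm evm']] := minPoly1P char0 u.
have hm i := height_le_minPoly i mE mon sm evm hu.
have -> : D u = - horner_alg u (map_poly (@dfrac K) m) / horner_alg u m^`().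
  apply: (canRL (mulfK evm')); apply/eqP; rewrite -addr_eq0 mulrC addrC.
  by rewrite -derivation_horner // evm derivation0.
set M := (minpoly_factor * (D0 + H))%N in hm.
have leSm : (size m <= S.+1)%N by rewrite (leq_trans sm).
have h1 : height_le (horner_alg u (map_poly (@dfrac K) m))
    (S.+1 * (M + M + S * D0)).
  apply: height_le_horner => // [|i]; last by rewrite coef_map; exact/height_le_dfrac/hm.
  exact: leq_trans (size_poly _ _) leSm.
have h2 : height_le (horner_alg u m^`()) (S.+1 * (M + M + S * D0)).
  apply: height_le_horner => // [|i]; first by rewrite (leq_trans (size_deriv_leq _)).
  rewrite coef_deriv -scalerMnl; apply: height_leMn.
  by apply: height_leW (hm _) _; exact: leq_addr.
apply: height_leW (height_leVf (height_leN h1) h2) _.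
set T := (S.+1 * _)%N.
apply: (@leq_trans (S.+1 * T)); first by rewrite mulSn leq_add2l leq_mul2r leNS orbT.
rewrite /derivation_factor /T -!mulnA !leq_mul2l /=.
rewrite mulnDl -mulnA mul2n -addnn leq_add2l leq_mul2l leq_addr.
by rewrite orbT.
Qed.

End DerivationHeight.

(** * Heights of powers *)

Section ScaledCharPoly.

(** For invertible [c] this is c^n times the characteristic polynomial of A / c. Clearing the
    denominator [c] keeps the coefficients in K[x], so that x can be specialised. *)
Definition scaled_char_poly (R : comNzRingType) n (c : R) (A : 'M[R]_n) :=
  \det ((c *: 'X)%:M - map_mx polyC A).

Lemma map_scaled_char_poly (R S : comNzRingType) (f : {rmorphism R -> S}) n c
    (A : 'M[R]_n) :
  map_poly f (scaled_char_poly c A) = scaled_char_poly (f c) (map_mx f A).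
Proof.
rewrite /scaled_char_poly -det_map_mx map_mxB map_scalar_mx /=.
rewrite linearZ /= map_polyX -!map_mx_comp.
congr (\det (_ - _)); apply/matrixP => i j.
by rewrite !mxE /= map_polyC.
Qed.

Lemma horner_scaled_char_poly (R : comNzRingType) n (c x : R) (A : 'M[R]_n) :
  (scaled_char_poly c A).[x] = \det ((c * x)%:M - A).
Proof.
rewrite /scaled_char_poly -horner_evalE -det_map_mx map_mxB map_scalar_mx /=.
rewrite horner_evalE hornerZ hornerX; congr (\det (_ - _)).
by apply/matrixP => i j; rewrite !mxE horner_evalE hornerC.
Qed.

Lemma size_scaled_char_poly (L : fieldType) n (c : L) (A : 'M[L]_n) :
  c != 0 -> size (scaled_char_poly c A) = n.+1.
Proof.
move=> c0; have -> : scaled_char_poly c A = c ^+ n *: char_poly (c^-1 *: A).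
  rewrite /char_poly -mul_polyC polyC_exp -detZ; congr (\det _).
  apply/matrixP => i j; rewrite !mxE mulrBr -polyCM mulrA mulfV // mul1r.
  by rewrite mulrnAr mul_polyC.
by rewrite size_scale ?expf_neq0 // size_char_poly.
Qed.

End ScaledCharPoly.

(** * Polynomials over K[x] and their specialisations *)

Section Fibres.
Variable K : closedFieldType.

Lemma horner_map_eval (P : {poly {poly K}}) x t :
  (map_poly (horner_eval x) P).[t] = P.[t%:P].[x].
Proof. by rewrite -[t in LHS](hornerC t x); exact: (horner_map (horner_eval x)). Qed.

Lemma separable_XnsubC (w : K) n : n%:R != 0 :> K -> w != 0 ->
  separable_poly ('X^n - w%:P).
Proof.
move=> n0 w0; rewrite separable_poly.unlock; apply/Bezout_eq1_coprimepP.
(* The Bezout relation is - w^-1 (T^n - w) + (n w)^-1 T n T^(n-1) = 1. *)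
exists (- (w^-1)%:P, (n%:R * w)^-1 *: 'X) => /=.
rewrite derivB derivXn derivC subr0 -scalerAl mulrnAr -exprS prednK; last first.
  by rewrite lt0n; apply: contraNneq n0 => ->.
rewrite mulNr mulrBr opprB -polyCM mulVf // -addrA -scaler_nat scalerA invfM.
by rewrite mulrAC mulVf // mul1r mul_polyC addNr addr0.
Qed.

(** If [P] vanishes identically at x = z, then x - z divides all its coefficients and can be split
    off. The induction is on the degree of the leading coefficient, which drops. *)
Lemma primitive_part (P : {poly {poly K}}) : P != 0 ->
  exists (g : {poly K}) (P1 : {poly {poly K}}), P = g *: P1 /\ forall z, map_poly (horner_eval z) P1 != 0.
Proof.
have [k] := ubnP (size (lead_coef P)); elim: k P => // k IHk P lt_k P0.
have [prim|] := pselect (forall z, map_poly (horner_eval z) P != 0).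
  by exists 1, P; rewrite scale1r.
move=> /existsNP[z /negP/negPn/eqP Pz].
have cz i : P`_i = ('X - z%:P) * (P`_i %/ ('X - z%:P)).
  rewrite mulrC divpK // dvdp_XsubCl rootE -horner_evalE -coef_map Pz.
  by rewrite coef0.
pose P2 := map_poly (fun c => c %/ ('X - z%:P)) P.
have P2E : P = ('X - z%:P) *: P2.
  by apply/polyP => i; rewrite coefZ coef_map_id0 ?div0p // -cz.
have P20 : P2 != 0 by apply: contra_neq P0 => P20; rewrite P2E P20 scaler0.
have [||g [P1 [P1E prim]]] := IHk P2 => //.
  rewrite -ltnS; apply: leq_trans lt_k; rewrite !ltnS.
  rewrite [in X in (_ < X)%N]P2E lead_coefZ.
  by rewrite size_monicM ?monicXsubC ?lead_coef_eq0 // size_XsubC.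
exists (('X - z%:P) * g), P1; split=> //.
by rewrite -scalerA -P1E.
Qed.

(** Since [P] is not a product g(x) p(T), some coefficient of its primitive part P1 has degree j > 0
    in x. Let c(T) collect the terms of x^j in P1. If c(t) is nonzero, then P1(x, t) is not constant
    in x and has a root. This root avoids the zeros z of [q] unless P1(z, t) = 0, which by
    primitivity holds for finitely many t only. *)
Lemma fibre_root (q : {poly K}) (P : {poly {poly K}}) : q != 0 -> P != 0 ->
  (forall (g p : {poly K}), P <> g *: map_poly polyC p) ->
  exists2 b : {poly K}, b != 0 & forall t, ~~ root b t ->
    exists2 x, ~~ root q x & root P.[t%:P] x.
Proof.
move=> q0 P0 Pnc; have [g [P1 [PE prim]]] := primitive_part P0.
have [k sk] : exists k, (1 < size (P1`_k)%R)%N.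
  apply: contrapT => /forallNP s1; apply: (Pnc g (map_poly (coefp 0) P1)).
  rewrite PE; congr (_ *: _); apply/polyP => i; rewrite !coef_map /=.
  by apply: size1_polyC; rewrite leqNgt; apply/negP.
pose j := (size P1`_k).-1.
pose c := map_poly (coefp j) P1.
have c0 : c != 0.
  apply/eqP => /polyP/(_ k); rewrite coef0 coef_map /= => /eqP.
  by rewrite -/(lead_coef _) lead_coef_eq0 -size_poly_eq0; case: size sk.
have cE t : c.[t] = P1.[t%:P]`_j.
  rewrite (@horner_coef_wide _ (size P1)) ?size_poly // horner_coef coef_sum.
  by apply: eq_bigr => i _; rewrite coef_map -polyC_exp coefMC.
have [rs qE] := closed_field_poly_normal q.
exists (c * \prod_(z <- rs) map_poly (horner_eval z) P1).
  by rewrite mulf_neq0 // prodf_seq_neq0; apply/allP => z _; apply/implyP.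
move=> t; rewrite rootM negb_or => /andP[ct bt].
have : size P1.[t%:P] != 1.
  apply: contra ct => /eqP s1; rewrite rootE cE nth_default // s1 /j.
  by case: size sk => [|[]].
move=> /closed_rootP[x Px]; exists x; last by rewrite PE hornerZ rootM Px orbT.
apply: contra bt; rewrite qE rootZ ?lead_coef_eq0 // root_prod_XsubC => xrs.
by rewrite (big_rem x) //= rootM rootE horner_map_eval -rootE Px.
Qed.

End Fibres.

(* The vector of basis elements is an eigenvector. *)
Lemma det_basis_eigen (L : fieldType) (E : fieldExtType L) n (X : n.-tuple E)
    (u : E) (c : L) (M : 'M[L]_n) :
  basis_of {:E} X -> (forall i : 'I_n, c *: (u * X`_i) = \sum_j M i j *: X`_j) ->
  \det ((c%:A * u)%:M - map_mx (in_alg E) M) = 0.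
Proof.
move=> bX XM; apply/eqP; rewrite -det_tr; apply/det0P.
have n_gt0 : (0 < n)%N by rewrite -(size_basis bX) adim_gt0.
have X0 : X`_0 != 0.
  by apply: (free_not0 (basis_free bX)); rewrite mem_nth ?size_tuple.
exists (\row_i X`_i).
  by apply: contraNneq X0 => /rowP/(_ (Ordinal n_gt0)); rewrite !mxE => ->.
rewrite -[\row_i _]trmxK -trmx_mul mulmxBl mul_scalar_mx.
apply/rowP => i; rewrite !mxE mulr_algl -scalerAl XM.
apply/eqP; rewrite subr_eq0; apply/eqP; apply: eq_bigr => j _.
by rewrite !mxE mulr_algl.
Qed.

Section PowerHeight.
Variables (K : closedFieldType) (F : fieldExtType (ratfun K)).
Hypothesis char0 : [pchar K] =i pred0.
Local Notation N := (\dim {:F}).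
Local Notation B := (ff_basis F).
Local Notation tofrac := (@FracField.tofrac {poly K}).

Definition mxpow (R : pzRingType) n (A : 'M[R]_n) k := iter k (mulmx A) 1%:M.

Lemma map_mxpow (R S : comNzRingType) (f : {rmorphism R -> S}) n (A : 'M[R]_n) k :
  map_mx f (mxpow A k) = mxpow (map_mx f A) k.
Proof. by elim: k => [|k IHk] /=; rewrite ?map_mx1 // map_mxM IHk. Qed.

Lemma mxpowZ (R : comNzRingType) (c : R) n (A : 'M[R]_n) k :
  mxpow (c *: A) k = c ^+ k *: mxpow A k.
Proof.
elim: k => [|k IHk] /=; first by rewrite expr0 scale1r.
by rewrite IHk -scalemxAl -scalemxAr scalerA exprS.
Qed.

Lemma mxpow_eigen (R : comNzRingType) (c : R) n (A : 'M[R]_n) (y : 'rV_n) k :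
  y *m A = c *: y -> y *m mxpow A k = c ^+ k *: y.
Proof.
move=> yA; elim: k => [|k IHk] /=; first by rewrite mulmx1 scale1r.
by rewrite mulmxA yA -scalemxAl IHk scalerA exprS.
Qed.

Definition embed (p : {poly K}) : F := (tofrac p)%:A.

Lemma embed_is_zmod_morphism : zmod_morphism embed.
Proof. by move=> p q; rewrite /embed tofracB scalerBl. Qed.

Lemma embed_is_monoid_morphism : monoid_morphism embed.
Proof.
split=> [|p q]; first by rewrite /embed tofrac1 scale1r.
by rewrite /embed tofracM alg_mul.
Qed.

HB.instance Definition _ :=
  GRing.isZmodMorphism.Build {poly K} F embed embed_is_zmod_morphism.
HB.instance Definition _ :=
  GRing.isMonoidMorphism.Build {poly K} F embed embed_is_monoid_morphism.

Lemma root_scaled_char_poly (u : F) (q : {poly K}) A :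
  tofrac q *: mul_matrix u = map_mx tofrac A ->
  (map_poly embed (scaled_char_poly q A)).[u] = 0.
Proof.
move=> qA; rewrite map_scaled_char_poly horner_scaled_char_poly.
have -> : map_mx embed A = map_mx (in_alg F) (map_mx tofrac A).
  by rewrite -map_mx_comp.
apply: (det_basis_eigen (vbasisP {:F})) => i.
have -> : u * B`_i = \sum_j mul_matrix u i j *: B`_j.
  by rewrite [LHS]coord_ff_basis; apply: eq_bigr => j _; rewrite mxE.
rewrite -qA scaler_sumr; apply: eq_bigr => j _.
by rewrite scalerA !mxE.
Qed.

Lemma height_le_power (u : F) D E n : ~ is_const u ->
  height_le u D -> height_le (u ^+ n) E -> (n <= N * (N * E))%N.
Proof.
move=> unc [q [A [q0 qA _ _]]] [q' [A' [q'0 qA' sq' sA']]].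
have [->//|n_gt0] := posnP n.
(* The comparison of the two descriptions of u^n is cleared of denominators, so that it can be
   evaluated at any x. *)
have powA : q' *: mxpow A n = q ^+ n *: A'.
  suff tE : map_mx tofrac (q' *: mxpow A n) = map_mx tofrac (q ^+ n *: A').
    apply/matrixP => i j; apply/eqP; rewrite -tofrac_eq.
    by have /matrixP/(_ i j)/eqP := tE; rewrite [X in X == _]mxE [X in _ == X]mxE.
  rewrite !map_mxZ map_mxpow -qA -qA' mxpowZ -[mxpow _ _]mul_matrixX.
  by rewrite /= !scalerA rmorphXn mulrC.
pose P := scaled_char_poly q A.
have sP x : ~~ root q x -> size (scaled_char_poly q.[x] (map_mx (horner_eval x) A)) = N.+1.
  by move=> qx; rewrite size_scaled_char_poly.
have P0 : P != 0.
  have [x qx] := closed_nonrootP _ q0.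
  apply/eqP => P0; have := sP x qx.
  by rewrite -[q.[x]]horner_evalE -map_scaled_char_poly -/P P0 map_poly0 size_poly0.
(* If [P] were g(x) p(T), then [u] would be a root of p, which has coefficients in K, and hence
   constant. *)
have [|b b0 bP] := fibre_root q0 P0.
  move=> g p PE; apply: unc.
  have [g0 p0] : g != 0 /\ p != 0.
    by split; apply: contraNneq P0 => r0; rewrite PE r0 ?scale0r ?rmorph0 ?scaler0.
  have := root_scaled_char_poly qA; rewrite -/P PE map_polyZ hornerZ => /eqP.
  have eg : embed g != 0.
    by rewrite /embed scaler_eq0 tofrac_eq0 (negPf g0) oner_eq0.
  rewrite mulf_eq0 => /orP[/eqP g00|]; first by case/eqP: eg.
  by rewrite -map_poly_comp => /eqP; apply: root_is_const.
have [x0 q'x0] := closed_nonrootP _ q'0.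
have [rb bE] := closed_field_poly_normal b.
(* A non-root w of [Z] is generic: it is nonzero, so it has n distinct n-th roots; none of them is
   exceptional for [fibre_root]; and w is not an eigenvalue of the matrix of u^n at [x0], so [Q]
   below is nonzero. *)
pose Z := 'X * scaled_char_poly q'.[x0] (map_mx (horner_eval x0) A') *
  \prod_(t <- rb) ('X - (t ^+ n)%:P).
have Z0 : Z != 0.
  rewrite !mulf_neq0 ?polyX_eq0 //; last exact/monic_neq0/monic_prod_XsubC.
  by rewrite -size_poly_eq0 size_scaled_char_poly.
have [w] := closed_nonrootP _ Z0.
rewrite !rootM !negb_or rootX => /andP[/andP[w0 Qx0] wb].
pose Q := \det ((q' * w%:P)%:M - A').
have QE x : Q.[x] = (scaled_char_poly q'.[x] (map_mx (horner_eval x) A')).[w].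
  rewrite horner_scaled_char_poly -horner_evalE -det_map_mx map_mxB map_scalar_mx.
  by rewrite /= horner_evalE hornerM hornerC.
have Q0 : Q != 0.
  by apply: contraNneq Qx0 => Q0; rewrite rootE -QE Q0 horner0.
have sQ : (size Q <= (N * E).+1)%N.
  apply: size_det_leq => i j; rewrite !mxE.
  rewrite (leq_trans (size_polyD _ _)) // size_polyN geq_max sA' andbT.
  case: eqP => _; rewrite ?mulr1n ?mulr0n ?size_poly0 //.
  by rewrite mulrC mul_polyC (leq_trans (size_scale_leq _ _)).
have [zs QzE] := closed_field_poly_normal Q.
have szs : (size zs <= N * E)%N.
  rewrite -ltnS; apply: leq_trans sQ.
  by rewrite QzE size_scale ?lead_coef_eq0 // size_prod_XsubC.
(* The points where w is an eigenvalue of the matrix of u^n are among the at most N E roots of [Q];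
   each contributes a factor of degree N, and every n-th root of w will be a root of [T]. *)
pose T := \prod_(z <- [seq z <- zs | ~~ root q z])
  scaled_char_poly q.[z] (map_mx (horner_eval z) A).
have T0 : T != 0.
  rewrite prodf_seq_neq0; apply/allP => z; rewrite mem_filter => /andP[qz _].
  by apply/implyP; rewrite -size_poly_eq0 sP.
have sT : (size T <= (N * (N * E)).+1)%N.
  apply: leq_trans (_ : (N * size [seq z <- zs | ~~ root q z]).+1 <= _)%N; last first.
    by rewrite ltnS leq_mul // (leq_trans _ szs) // size_filter count_size.
  rewrite /T; elim: zs {QzE szs T T0} => [|z zs IHzs] /=; first by rewrite big_nil size_poly1 muln0.
  case: ifP => // qz; rewrite big_cons /= mulnS.
  by apply: size_mulD => //; rewrite sP.
have [rs rsE] := closed_field_poly_normal ('X^n - w%:P).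
rewrite lead_coefDl ?lead_coefXn ?scale1r in rsE; last first.
  by rewrite size_polyXn size_polyN ltnS (leq_trans (size_polyC_leq1 _)).
have srs : size rs = n.
  by apply: succn_inj; rewrite -(size_prod_XsubC rs id) -rsE size_XnsubC.
have urs : uniq rs.
  rewrite -separable_prod_XsubC -rsE; apply: separable_XnsubC; last exact: w0.
  by rewrite ((pcharf0P K).1 char0) -lt0n.
rewrite -srs -ltnS; apply: leq_trans sT; apply: max_poly_roots => //.
apply/allP => t; rewrite -root_prod_XsubC -rsE rootE !hornerE subr_eq0 => /eqP tw.
have bt : ~~ root b t.
  rewrite bE rootZ ?lead_coef_eq0 // root_prod_XsubC; apply: contra wb => tb.
  by rewrite (big_rem t) //= rootM rootE !hornerE -tw subrr eqxx.
have [x qx Px] := bP t bt.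
have Pt : root (scaled_char_poly q.[x] (map_mx (horner_eval x) A)) t.
  by rewrite -[q.[x]]horner_evalE -map_scaled_char_poly rootE horner_map_eval.
(* An eigenvector at x for t is one of the n-th power for t^n = w. By [powA], divided by the nonzero
   q(x)^n, it shows that Q(x) = 0. *)
have xzs : x \in zs.
  rewrite -root_prod_XsubC -(rootZ _ _ (_ : lead_coef Q != 0)) ?lead_coef_eq0 //.
  rewrite -QzE rootE QE horner_scaled_char_poly; apply/det0P.
  move: Pt; rewrite rootE horner_scaled_char_poly => /det0P[y y0 yA].
  exists y => //; apply/eqP; rewrite mulmxBr subr_eq0 mul_mx_scalar; apply/eqP.
  move/eqP: yA; rewrite mulmxBr subr_eq0 mul_mx_scalar => /eqP/esym yA.
  have qxn : q.[x] ^+ n != 0 by rewrite expf_neq0.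
  apply: (scalerI qxn); rewrite scalemxAr.
  have /= := congr1 (fun M => y *m map_mx (horner_eval x) M) powA.
  rewrite !map_mxZ map_mxpow -!scalemxAr.
  rewrite (mxpow_eigen _ yA) /= !horner_evalE horner_exp => <-.
  by rewrite !scalerA exprMn tw; congr (_ *: _); rewrite [LHS]mulrCA !mulrA.
apply/rootP; rewrite /T (big_rem x) /=; last by rewrite mem_filter qx.
by rewrite hornerM (rootP Pt) mul0r.
Qed.

End PowerHeight.

(** * Vanishing sums *)

(** Induction on [r]. Scale a kernel vector so that its last entry is 1. Differentiating the
    relation of order j and subtracting that of order j + 1 gives relations between the derivatives
    of the other entries, which vanish by induction. So all entries are constants, and the relation
    of order 0 contradicts independence. *)
Lemma wronskian_free (K E : fieldType) (k : {rmorphism K -> E}) (D : E -> E) :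
  (forall u v, D (u + v) = D u + D v) ->
  (forall u v, D (u * v) = D u * v + u * D v) ->
  (forall u, D u = 0 -> exists a, u = k a) ->
  forall r (v : nat -> E),
  (forall c : nat -> K, \sum_(i < r) k (c i) * v i = 0 ->
    forall i, (i < r)%N -> c i = 0) ->
  forall y : nat -> E,
  (forall j, (j < r)%N -> \sum_(i < r) y i * iter j D (v i) = 0) ->
  forall i, (i < r)%N -> y i = 0.
Proof.
move=> DD DM Dker.
have D0 : D 0 = 0.
  by have /eqP := DD 0 0; rewrite addr0 addrC -subr_eq subrr => /eqP.
have D1 : D 1 = 0.
  have /eqP := DM 1 1.
  by rewrite !mulr1 mul1r addrC -subr_eq subrr => /eqP.
elim=> // r IHr v free y ysum.
have free_r (c : nat -> K) : \sum_(i < r) k (c i) * v i = 0 ->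
    forall i, (i < r)%N -> c i = 0.
  move=> csum i lt_i; have := free (fun i => if (i < r)%N then c i else 0).
  rewrite big_ord_recr /= ltnn rmorph0 mul0r addr0.
  under eq_bigr => j _ do rewrite ltn_ord.
  by move=> /(_ csum i (ltnW lt_i)); rewrite lt_i.
have [yr0|yr] := eqVneq (y r) 0.
  have yi := IHr v free_r y.
  move=> i; rewrite ltnS leq_eqVlt => /predU1P[->//|]; apply: yi => j lt_j.
  by have := ysum j (ltnW lt_j); rewrite big_ord_recr /= yr0 mul0r addr0.
pose z i := y i / y r.
have zr : z r = 1 by rewrite /z divff.
have zsum j : (j < r.+1)%N -> \sum_(i < r.+1) z i * iter j D (v i) = 0.
  move=> lt_j; under eq_bigr => i _ do rewrite /z mulrAC.
  by rewrite -mulr_suml ysum // mul0r.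
have Dz i : (i < r.+1)%N -> D (z i) = 0.
  rewrite ltnS leq_eqVlt => /predU1P[->|]; first by rewrite zr.
  apply: (IHr v free_r (fun i => D (z i))) => j lt_j.
  have := congr1 D (zsum j (ltnW lt_j)); rewrite D0 (big_morph D DD D0).
  under eq_bigr => l _ do rewrite DM.
  rewrite big_split /= [X in _ + X](zsum j.+1) // addr0.
  by rewrite big_ord_recr /= zr D1 mul0r addr0.
have /choice[c cE] : forall i, exists a, (i < r.+1)%N -> z i = k a.
  move=> i; case: (ltnP i r.+1) => [lt_i|_]; last by exists 0.
  by have [a aE] := Dker _ (Dz i lt_i); exists a.
have := free c; under eq_bigr => i _ do rewrite -cE //.
move=> /(_ (zsum 0%N isT) r (ltnSn r)) cr0.
by have := cE r (ltnSn r); rewrite cr0 rmorph0 zr => /eqP; rewrite oner_eq0.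
Qed.

(* A relation of minimal support among those involving [w i] has all its terms
   but [w i] linearly independent. *)
Lemma minimal_relation (K E : fieldType) (k : {rmorphism K -> E}) (I : finType)
    (w : I -> E) (i : I) :
  \sum_j w j = 0 ->
  exists (A : {set I}) (c : I -> K), [/\ i \notin A, forall j, j \in A -> c j != 0,
    w i = \sum_(j in A) k (c j) * w j &
    forall l : I -> K, \sum_(j in A) k (l j) * w j = 0 ->
      forall j, j \in A -> l j = 0].
Proof.
move=> w0.
pose P (A : {set I}) (c : I -> K) := [/\ i \in A, forall j, (j \in A) = (c j != 0) &
  \sum_j k (c j) * w j = 0].
have exP : exists A, `[< exists c, P A c >].
  exists [set: I]; apply/asboolP; exists (fun=> 1); split=> // [j|].
    by rewrite in_setT oner_eq0.
  by under eq_bigr => j _ do rewrite rmorph1 mul1r.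
have [A /minsetP[/asboolP[c [iA cA c0]] minA]] := ex_minset exP.
have ci : c i != 0 by rewrite -cA.
have sumA (l : I -> K) : (forall j, j \notin A -> l j = 0) ->
    \sum_j k (l j) * w j = k (l i) * w i + \sum_(j in A :\ i) k (l j) * w j.
  move=> lA; rewrite (bigD1 i) //=; congr (_ + _).
  rewrite [RHS](eq_bigl (fun j => (j != i) && (j \in A))); last first.
    by move=> j; rewrite !inE.
  rewrite big_mkcondr; apply: eq_bigr => j _.
  by case: ifPn => // /lA ->; rewrite rmorph0 mul0r.
exists (A :\ i), (fun j => - (c j / c i)); split=> [|j||l lsum j].
- by rewrite !inE eqxx.
- by rewrite !inE cA oppr_eq0 mulf_eq0 invr_eq0 (negPf ci) orbF => /andP[].
- have kci : k (c i) != 0 by rewrite fmorph_eq0.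
  have /eqP := c0; rewrite sumA => [|j]; last by rewrite cA negbK => /eqP.
  rewrite addr_eq0 => /eqP cwi; apply: (mulfI kci); rewrite cwi -sumrN mulr_sumr.
  apply: eq_bigr => j _; rewrite rmorphN mulNr mulrN rmorphM fmorphV mulrA.
  by rewrite mulrCA mulfV // mulr1.
move=> jA; apply/eqP/negPn/negP => lj.
pose l' x := if x \in A :\ i then l x else 0.
have l'sum : \sum_j k (l' j) * w j = 0.
  rewrite sumA => [|x xA]; last by rewrite /l' !inE (negPf xA) andbF.
  rewrite {1}/l' !inE eqxx rmorph0 mul0r add0r -[RHS]lsum.
  by apply: eq_bigr => x xA; rewrite /l' xA.
(* Subtracting this multiple of the second relation cancels the coefficient of [j] and keeps that of
   [i], so the support shrinks, against minimality. *)
pose c' x := c x - c j / l j * l' x.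
have jAi : j \in A by move: jA; rewrite !inE => /andP[].
have sub : [set x | c' x != 0] \subset A.
  apply/subsetP => x; rewrite inE; apply: contraR => xA.
  have /eqP cx0 : c x == 0 by move: xA; rewrite cA negbK.
  by rewrite /c' cx0 /l' !inE (negPf xA) andbF mulr0 subrr.
have c'j : c' j = 0.
  by rewrite /c' /l' jA divfK ?subrr.
suff : [set x | c' x != 0] = A by move/setP/(_ j); rewrite inE jAi c'j eqxx.
apply: minA => //; apply/asboolP; exists c'; split=> [|x|].
- by rewrite inE /c' /l' !inE eqxx mulr0 subr0.
- by rewrite inE.
under eq_bigr => x _ do rewrite /c' rmorphB rmorphM mulrBl -mulrA.
by rewrite sumrB c0 -mulr_sumr l'sum mulr0 subrr.
Qed.

Lemma log_derivative_div (E : fieldType) (D : E -> E) u v :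
  (forall u v, D (u * v) = D u * v + u * D v) -> u != 0 -> v != 0 ->
  D (u / v) / (u / v) = D u / u - D v / v.
Proof.
move=> DM u0 v0; have uE : u = (u / v) * v by rewrite divfK.
rewrite [in RHS]uE; have : u / v != 0 by rewrite mulf_neq0 ?invr_eq0.
move: (u / v) => z z0.
by rewrite DM; field; rewrite z0 v0.
Qed.

(** * Terms with a ratio of bounded height *)

Section Neighbours.
Variables (K : closedFieldType) (F : fieldExtType (ratfun K)).
Hypothesis char0 : [pchar K] =i pred0.
Variables (S H : nat).
Local Notation N := (\dim {:F}).
Local Notation B := (ff_basis F).
Hypothesis leNS : (N <= S)%N.
Hypothesis leBH : forall i : 'I_N, height_le B`_i H.
Variables (D : F -> F) (derD : derivation D).

(** From order j to j + 1 a height X becomes at most d (X + H) + X + T with d =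
    [derivation_factor S]. When X is at least H + T, this is at most 2 (d + 1) X. *)
Definition iter_factor := ((derivation_factor S).+1 * 2)%N.

Lemma iterD_constM a v j :
  iter j D (const_ff F a * v) = const_ff F a * iter j D v.
Proof. by elim: j => //= j ->; rewrite derivation_constM. Qed.

Lemma iterD_sum (I : finType) (u : I -> F) j :
  iter j D (\sum_i u i) = \sum_i iter j D (u i).
Proof. by elim: j => //= j ->; rewrite derivation_sum. Qed.

(** This recursion involves [v] only through its logarithmic derivative, so the height of [v], which
    may grow with the exponents, never enters. *)
Lemma iterD_logD v j : v != 0 ->
  iter j.+1 D v / v = D (iter j D v / v) + iter j D v / v * (D v / v).
Proof.
move=> v0; have [_ DM _] := derD; set u := iter j D v / v.
have -> : iter j.+1 D v = D (u * v) by rewrite /u divfK.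
by rewrite DM mulrDl mulfK // mulrA.
Qed.

Lemma height_le_iterD v T j : v != 0 -> height_le (D v / v) T ->
  height_le (iter j D v / v) (iter_factor ^ j * (H + T)).
Proof.
move=> v0 hv; elim: j => [|j IHj].
  rewrite divff // -(rmorph1 (const_ff F)).
  exact: height_leW (height_le_const _ _) _.
rewrite iterD_logD //.
apply: height_leW (height_leD (height_le_derivation char0 leNS leBH derD IHj)
  (height_leM IHj hv)) _.
have p_gt0 : (0 < iter_factor ^ j)%N by rewrite expn_gt0 muln_gt0.
rewrite expnS; set X := (_ ^ j)%N in p_gt0 *; rewrite /iter_factor.
move: (derivation_factor S) => d; nia.
Qed.

Definition neighbour_bound T := (S.+1 * (S ^ S * (S * (iter_factor ^ S * (H + T)))))%N.

Lemma neighbour (I : finType) (w : I -> F) T i :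
  (#|I| <= S)%N -> (forall j, w j != 0) -> \sum_j w j = 0 ->
  (forall j, height_le (D (w j) / w j) T) ->
  exists2 j, j != i & height_le (w j / w i) (neighbour_bound (T + T)).
Proof.
move=> leIS wn0 w0 hw.
have [A [c [iA cA wi free]]] := minimal_relation (const_ff F) i w0.
have wi0 : w i != 0 := wn0 i.
pose r := #|A|; pose e n := nth i (enum A) n; pose v n := w (e n) / w i.
have eA n : (n < r)%N -> e n \in A.
  by move=> lt_n; rewrite -mem_enum mem_nth // -cardE.
have sumA (u : I -> F) : \sum_(j in A) u j = \sum_(n < r) u (e n).
  by rewrite -big_enum (big_nth i) -cardE big_mkord.
have vn0 n : v n != 0 by rewrite mulf_neq0 ?invr_eq0.
have free_v (a : nat -> K) : \sum_(n < r) const_ff F (a n) * v n = 0 ->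
    forall n, (n < r)%N -> a n = 0.
  move=> asum n lt_n.
  have := free (fun j => a (index j (enum A))); rewrite sumA.
  have ie m : (m < r)%N -> index (e m) (enum A) = m.
    by move=> lt_m; rewrite index_uniq ?enum_uniq // -cardE.
  move=> fr; rewrite -(ie n lt_n); apply: fr (eA n lt_n).
  apply: (mulIf (invr_neq0 wi0)); rewrite mul0r -[RHS]asum mulr_suml.
  by apply: eq_bigr => m _; rewrite ie // mulrA.
pose y n := const_ff F (c (e n)) * v n.
have y1 : \sum_(n < r) y n = 1.
  apply: (mulIf wi0); rewrite mul1r [RHS]wi sumA mulr_suml.
  by apply: eq_bigr => n _; rewrite /y /v mulrA divfK.
pose W := \matrix_(j < r, n < r) (iter j D (v n) / v n).
have uW : W \in unitmx.
  (* Dividing a kernel vector of [W] entrywise by the [v n] gives one of the Wronskian matrix. It is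
     extended by 0 to all natural indices. *)
  rewrite unitmxE unitfE -det_tr; apply/negP => /det0P[x /eqP x0 xW].
  apply: x0; apply/rowP => n; rewrite mxE.
  pose x' m := if insub m is Some m' then x 0 m' / v m else 0.
  have x'E (m : 'I_r) : x' m = x 0 m / v m.
    by rewrite /x' insubT // => lt_m; congr (x 0 _ / _); exact/val_inj.
  have [zD DM _] := derD.
  have := wronskian_free (derivationD derD) DM
    (fun u => @derivation_eq0 _ _ char0 _ derD u) free_v (y := x').
  move=> /(_ _ n (ltn_ord n)); rewrite x'E => H0.
  apply: (mulIf (invr_neq0 (vn0 n))); rewrite mul0r; apply: H0 => j lt_j.
  have /rowP/(_ (Ordinal lt_j)) := xW; rewrite !mxE => xWj; rewrite -[RHS]xWj.
  by apply: eq_bigr => m _; rewrite x'E !mxE mulrAC mulrA.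
have r_gt0 : (0 < r)%N.
  by rewrite lt0n; apply/eqP => r0; move: y1; rewrite r0 big_ord0 => /esym/eqP; rewrite oner_eq0.
pose i0 := Ordinal r_gt0.
(* Row j is the j-th derivative of the relation [y1]: the constants pass through D, and the
   derivatives of 1 vanish. *)
have Wy : W *m \col_n y n = \col_j (j == i0)%:R.
  apply/colP => j; rewrite !mxE.
  have -> : (j == i0)%:R = iter j D 1.
    rewrite -val_eqE /=; case: (val j) => //= m.
    elim: m => [|m IHm] /=; last by rewrite -IHm derivation0.
    by rewrite -(rmorph1 (const_ff F)) derivation_const.
  rewrite -y1 iterD_sum; apply: eq_bigr => n _.
  by rewrite !mxE iterD_constM mulrCA divfK.
have y0E : y 0%N = invmx W i0 i0.
  have /colP/(_ i0) : \col_n y n = invmx W *m \col_j (j == i0)%:R.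
    by rewrite -Wy mulKmx.
  rewrite !mxE => ->; rewrite (bigD1 i0) //= mxE eqxx mulr1 big1 ?addr0 // => j ji0.
  by rewrite mxE (negPf ji0) mulr0.
(* Any member of the support would do. The constant coefficient has height 0, so removing it costs
   nothing. *)
exists (e 0%N); first by apply: contraNneq iA => <-; exact: eA.
have ce0 : c (e 0%N) != 0 by apply/cA/eA.
have -> : w (e 0%N) / w i = const_ff F (c (e 0%N))^-1 * y 0%N.
  by rewrite /y mulrA -rmorphM mulVf // rmorph1 mul1r.
have lerS : (r <= S)%N := leq_trans (max_card _) leIS.
have S_gt0 : (0 < S)%N := leq_trans r_gt0 lerS.
pose M := (iter_factor ^ S * (H + (T + T)))%N.
have hW j n : height_le (W j n) M.
  rewrite mxE; apply: (@height_leW _ _ _ (iter_factor ^ j * (H + (T + T)))).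
    apply: height_le_iterD => //.
    have [_ DM _] := derD.
    have -> : D (v n) / v n = D (w (e n)) / w (e n) - D (w i) / w i.
      exact: log_derivative_div.
    exact: height_leD (hw _) (height_leN (hw _)).
  by rewrite leq_mul2r leq_pexp2l ?orbT // ltnW // (leq_trans (ltn_ord j)).
rewrite y0E; apply: height_leW (height_leM (height_le_const _ _)
  (height_le_invmx i0 i0 uW hW)) _.
rewrite add0n /neighbour_bound -/M; apply: leq_mul => //.
apply: leq_mul; last exact: leq_mul.
by apply: leq_trans (leq_pexp2l S_gt0 lerS); case: (r) lerS => // r' ?; rewrite leq_exp2r.
Qed.

End Neighbours.

(** * Bounds for the exponents *)

Section LogDerivative.
Variables (E : fieldType) (D : E -> E).
Hypothesis DM : forall u v, D (u * v) = D u * v + u * D v.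

Lemma log_derivativeM u v : u != 0 -> v != 0 ->
  D (u * v) / (u * v) = D u / u + D v / v.
Proof. by move=> u0 v0; rewrite DM; field; rewrite u0 v0. Qed.

Lemma log_derivativeX u n : u != 0 -> D (u ^+ n) / u ^+ n = (D u / u) *+ n.
Proof.
move=> u0.
have D1 : D 1 = 0.
  have /eqP := DM 1 1.
  by rewrite !mulr1 mul1r addrC -subr_eq subrr => /eqP.
elim: n => [|n IHn]; first by rewrite expr0 D1 mul0r mulr0n.
by rewrite exprS log_derivativeM ?expf_neq0 // IHn mulrS.
Qed.

End LogDerivative.

Section ExponentBounds.
(** [S] bounds the degree of F over K(x) and the number of terms, [H] the heights of the basis and
    [h] those of the data. *)
Variables (S H h : nat).

Definition power_bound X := (S * (S * X))%N.
Definition log_bound := (derivation_factor S * (h + H) + S * h)%N.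
(** A term has logarithmic derivative of height twice [log_bound], and [neighbour] doubles this for
    quotients of terms. The factor [S.+1] makes the bound valid for the inverse ratio too. *)
Definition ratio_bound :=
  (S.+1 * neighbour_bound S H ((log_bound + log_bound) + (log_bound + log_bound)))%N.
Definition first_bound := power_bound (S * (h + S * h) + ratio_bound).
Definition second_bound :=
  power_bound (S * h + (ratio_bound + (h + first_bound * h))).
Definition exponent_bound := (first_bound + second_bound)%N.

Variables (K : closedFieldType) (F : fieldExtType (ratfun K)).
Hypothesis char0 : [pchar K] =i pred0.
Local Notation N := (\dim {:F}).
Local Notation B := (ff_basis F).
Hypothesis leNS : (N <= S)%N.
Hypothesis leBH : forall i : 'I_N, height_le B`_i H.

(** Dividing by [c] bounds the height of u^n, and [height_le_power] turns this into a bound for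
    n. *)
Lemma exponent_le (c u : F) n X G : c != 0 -> ~ is_const u -> 
  (exists D, height_le u D) -> height_le c G ->
  height_le (c * u ^+ n) X -> (n <= power_bound (S * G + X))%N.
Proof.
move=> c0 unc [D hu] hc hcu.
have hun : height_le (u ^+ n) (S * G + X).
  rewrite -[u ^+ n](mulKf c0).
  apply: height_leW (height_leM (height_leV hc) hcu) _.
  by rewrite leq_add2r leq_mul2r leNS orbT.
apply: leq_trans (height_le_power char0 unc hu hun) _.
by apply: leq_mul => //; rewrite leq_mul2r leNS orbT.
Qed.

Section TwoSums.
Variables (d t : nat) (a alpha : 'I_d -> F) (b beta : 'I_t -> F) (f : F).
Variables (n m : nat).
Hypotheses (dtS : (d + t < S)%N) (t_gt0 : (0 < t)%N).
Hypotheses (a0 : forall i, a i != 0) (al0 : forall i, alpha i != 0).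
Hypotheses (b0 : forall j, b j != 0) (be0 : forall j, beta j != 0).
Hypotheses (f0 : f != 0).
Hypotheses (alnc : forall i, ~ is_const (alpha i)).
Hypotheses (benc : forall j, ~ is_const (beta j)).
Hypotheses (ber : forall i j, i != j -> ~ is_const (beta i / beta j)).
Hypotheses (ha : forall i, height_le (a i) h) (hal : forall i, height_le (alpha i) h).
Hypotheses (hb : forall j, height_le (b j) h) (hbe : forall j, height_le (beta j) h).
Hypothesis (hf : height_le f h).
(** The sign of the second sequence is absorbed into its coefficients. The equation is then
    symmetric, and the section can be applied to the sequences in either order. *)
Hypothesis sum_eq : slrs a alpha n + slrs b beta m = f.

Definition term (i : 'I_d + 'I_t + unit) : F :=
  match i with
  | inl (inl i) => a i * alpha i ^+ n
  | inl (inr j) => b j * beta j ^+ m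
  | inr _ => - f
  end.

Lemma term_neq0 i : term i != 0.
Proof. by case: i => [[i|j]|[]] /=; rewrite ?oppr_eq0 ?mulf_neq0 ?expf_neq0. Qed.

Lemma sum_term : \sum_i term i = 0.
Proof.
rewrite !big_sumType /= [X in _ + X](big_pred1 tt) => [|[]//].
by rewrite [X in X - f]sum_eq subrr.
Qed.

Lemma term_neighbour i : exists2 j, j != i &
  height_le (term j / term i) ratio_bound /\
  height_le (term i / term j) ratio_bound.
Proof.
have [D derD] := derivation_exists F char0; have [zD DM _] := derD.
have hlog u : u != 0 -> height_le u h -> height_le (D u / u) log_bound.
  move=> u0 hu; apply: height_leW (height_leVf (height_le_derivation char0 leNS leBH derD hu) hu) _.
  by rewrite leq_add2l leq_mul2r leNS orbT.
(* The exponents enter as integer multiples, which do not increase the height. *)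
have hterm j : height_le (D (term j) / term j) (log_bound + log_bound).
  case: j => [[i'|j]|[]] /=.
  - rewrite (log_derivativeM DM (a0 i') (expf_neq0 n (al0 i'))).
    rewrite (log_derivativeX DM _ (al0 i')).
    exact: height_leD (hlog _ (a0 i') (ha i'))
      (height_leMn _ (hlog _ (al0 i') (hal i'))).
  - rewrite (log_derivativeM DM (b0 j) (expf_neq0 m (be0 j))).
    rewrite (log_derivativeX DM _ (be0 j)).
    exact: height_leD (hlog _ (b0 j) (hb j))
      (height_leMn _ (hlog _ (be0 j) (hbe j))).
  rewrite (derivationN derD) invrN mulrNN.
  by apply: height_leW (hlog _ f0 hf) _; exact: leq_addr.
have leI : (#|{: 'I_d + 'I_t + unit}| <= S)%N.
  by rewrite !card_sum !card_ord card_unit addn1.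
have [j ji hj] := neighbour char0 leNS leBH derD i leI term_neq0 sum_term hterm.
exists j => //; split; first by apply: height_leW hj _; rewrite leq_pmull.
rewrite -[term i / _]invf_div; apply: height_leW (height_leV hj) _.
by rewrite leq_mul2r ltnW ?orbT.
Qed.

Lemma height_le_div (u v : F) : height_le u h -> height_le v h ->
  height_le (u / v) (h + S * h).
Proof.
move=> hu hv; apply: height_leW (height_leVf hu hv) _.
by rewrite leq_add2l leq_mul2r leNS orbT.
Qed.

Lemma power_ratio_le (c c' u u' : F) k : c != 0 -> c' != 0 -> u != 0 -> u' != 0 ->
  height_le c h -> height_le c' h -> height_le u h -> height_le u' h ->
  ~ is_const (u / u') ->
  height_le (c * u ^+ k / (c' * u' ^+ k)) ratio_bound -> (k <= first_bound)%N.
Proof.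
move=> c0 c'0 u0 u'0 hc hc' hu hu' unc hr.
apply: (@exponent_le (c / c') (u / u')) => //.
- by rewrite mulf_neq0 ?invr_eq0.
- by exists (h + S * h)%N; exact: height_le_div.
- exact: height_le_div.
by rewrite expr_div_n mulf_div.
Qed.

Lemma power_quotient_le (c u : F) k : c != 0 -> ~ is_const u ->
  height_le c h -> height_le u h ->
  height_le (c * u ^+ k / - f) ratio_bound -> (k <= first_bound)%N.
Proof.
move=> c0 unc hc hu hr; apply: (@exponent_le (c / - f) u) => //.
- by rewrite mulf_neq0 ?invr_eq0 ?oppr_eq0.
- by exists h.
- exact: height_le_div (height_leN hf).
by rewrite mulrAC.
Qed.

(** The neighbour of the fixed term f belongs to one of the two sequences, whose exponent is then
    bounded. *)
Lemma one_exponent_le : (n <= first_bound)%N \/ (m <= first_bound)%N.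
Proof.
have [[[i|j]|[]] //= _ [hj _]] := term_neighbour (inr tt).
- by left; apply: power_quotient_le hj.
by right; apply: power_quotient_le hj.
Qed.

(** The neighbour of the first term of the second sequence is of three kinds. A term of the first
    sequence has bounded height because n is bounded; another term of the second sequence gives a
    power of the nonconstant beta_j / beta_j0; and f is fixed. *)
Lemma second_exponent_le : (n <= first_bound)%N -> (m <= exponent_bound)%N.
Proof.
move=> le_n; pose j0 := Ordinal t_gt0.
have [[[i|j]|[]] /= ji [hj hj']] := term_neighbour (inl (inr j0)).
- apply: leq_trans (leq_addl _ _).
  apply: (@exponent_le (b j0) (beta j0)) => //; first by exists h.
  have w0 : a i * alpha i ^+ n != 0 by rewrite mulf_neq0 ?expf_neq0.
  rewrite -[X in height_le X](divfK w0); apply: height_leM => //.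
  apply: height_leM => //; apply: height_leW (height_leX n (hal i)) _.
  by rewrite leq_mul2r le_n orbT.
- apply: leq_trans (leq_addr _ _).
  by apply: (power_ratio_le _ _ _ _ _ _ _ _ _ hj) => //; apply: ber.
apply: leq_trans (leq_addr _ _).
by apply: power_quotient_le hj'.
Qed.

End TwoSums.

End ExponentBounds.

(** * Effectivity *)

Section InputSize.
Variable K : fieldType.

Lemma tree_size_seq (s : seq (tree K)) :
  tree_size (enc_seq s) = (sumn [seq tree_size x | x <- s] + (size s).+1)%N.
Proof. by elim: s => //= x s ->; lia. Qed.

Lemma size_lt_tree_size (s : seq (tree K)) : (size s < tree_size (enc_seq s))%N.
Proof. by rewrite tree_size_seq leq_addl. Qed.

Lemma nth_lt_tree_size x0 (s : seq (tree K)) i : (i < size s)%N ->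
  (tree_size (nth x0 s i) < tree_size (enc_seq s))%N.
Proof.
elim: s i => // x s IHs [_|i lt_i] /=; first by lia.
by have := IHs i lt_i; lia.
Qed.

Lemma image_lt_tree_size d (u : 'I_d -> tree K) i :
  (tree_size (u i) < tree_size (enc_seq [seq u j | j <- enum 'I_d]))%N.
Proof.
have lt_i : (i < size (enum 'I_d))%N by rewrite size_enum_ord.
have := @nth_lt_tree_size Defs.Nil [seq u j | j <- enum 'I_d] i.
by rewrite size_map (nth_map i) // nth_ord_enum; apply.
Qed.

Lemma dim_lt_tree_size d (u : 'I_d -> tree K) :
  (d < tree_size (enc_seq [seq u j | j <- enum 'I_d]))%N.
Proof. by have := size_lt_tree_size [seq u j | j <- enum 'I_d]; rewrite size_map size_enum_ord. Qed.

Lemma size_poly_lt_tree_size (p : {poly K}) : (size p < tree_size (enc_poly p))%N.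
Proof. by have := size_lt_tree_size [seq Leaf c | c <- p]; rewrite size_map. Qed.

Variable F : fieldExtType (ratfun K).
Local Notation N := (\dim {:F}).
Local Notation B := (ff_basis F).
Local Notation tofrac := (@FracField.tofrac {poly K}).

Lemma frac_size_le (r : ratfun K) S : (tree_size (enc_ratfun r) <= S)%N ->
  (size (frac_num r) <= S.+1)%N /\ (size (frac_den r) <= S.+1)%N.
Proof.
have := size_poly_lt_tree_size (frac_num r).
have := size_poly_lt_tree_size (frac_den r).
rewrite [tree_size (enc_ratfun r)]/=.
move: (size (frac_num r)) (size (frac_den r)) (tree_size (enc_poly _))
  (tree_size (enc_poly _)) => k l x y kx ly xy.
by split; lia.
Qed.

Lemma frac_den_neq0 (r : ratfun K) : frac_den r != 0.
Proof. by have [_ _ /monic_neq0] := frac_num_den r. Qed.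

Lemma size_prod_le (I : finType) (p : I -> {poly K}) D :
  (forall i, (size (p i) <= D.+1)%N) -> (size (\prod_i p i)%R <= (#|I| * D).+1)%N.
Proof.
move=> sp; rewrite cardE -big_enum; elim: (enum I) => [|i s IHs].
  by rewrite big_nil size_poly1.
by rewrite big_cons mulSn size_mulD.
Qed.

(** The product of all N^2 denominators serves as common denominator; each numerator is multiplied
    by the denominators of the other entries. *)
Lemma height_le_entries (u : F) S :
  (forall i j, tree_size (enc_ratfun (mul_matrix u i j)) <= S)%N ->
  height_le u (N * N * S).
Proof.
move=> sM.
pose num x := frac_num (mul_matrix u x.1 x.2) : {poly K}.
pose den x := frac_den (mul_matrix u x.1 x.2) : {poly K}.
have cI : (N * N = #|{: 'I_N * 'I_N}|)%N by rewrite card_prod !card_ord.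
exists (\prod_x den x).
exists (\matrix_(i, j) \prod_x (if x == (i, j) then num x else den x)).
split=> [||| i j].
- by apply/prodf_neq0 => x _; exact: frac_den_neq0.
- apply/matrixP => i j; rewrite [LHS]mxE [RHS]mxE [in RHS]mxE.
  have [rE _ _] := frac_num_den (mul_matrix u i j); rewrite [X in _ * X]rE.
  rewrite (bigD1 (i, j)) //= [in RHS](bigD1 (i, j)) //= eqxx.
  rewrite [X in _ = tofrac (_ * X)](eq_bigr den) => [|x /negPf ->] //.
  rewrite !tofracM mulrC mulrA divfK ?tofrac_eq0 ?frac_den_neq0 //.
- by rewrite cI; apply: size_prod_le => x; have [] := frac_size_le (sM x.1 x.2).
rewrite mxE cI; apply: size_prod_le => x.
by have [? ?] := frac_size_le (sM x.1 x.2); case: ifP.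
Qed.

Definition basis_height S := (S * S * S)%N.
Definition data_height S := (S * (S + basis_height S))%N.

(** The matrix of a basis element is a part of the multiplication table, so its entries are encoded
    by subtrees of [enc_field F]. *)
Lemma height_le_basis S (i : 'I_N) : (tree_size (enc_field F) <= S)%N ->
  height_le B`_i (basis_height S).
Proof.
move=> sF.
have leNS : (N <= S)%N by apply: ltnW; apply: leq_trans sF; exact: dim_lt_tree_size.
apply: (@height_leW _ _ _ (N * N * S)); last by rewrite !leq_mul.
apply: height_le_entries => j k; rewrite mxE -!tnth_nth.
set u := fun j => tnth B i * tnth B j.
have h1 : (tree_size (enc_elts u) < tree_size (enc_field F))%N.
  exact: (image_lt_tree_size (fun i => enc_elts (fun j => tnth B i * tnth B j))).
have h2 : (tree_size (enc_elt (u j)) < tree_size (enc_elts u))%N.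
  exact: (image_lt_tree_size (fun j => enc_elt (u j))).
have h3 : (tree_size (enc_ratfun (coord B k (u j))) < tree_size (enc_elt (u j)))%N.
  exact: (image_lt_tree_size (fun k => enc_ratfun (coord B k (u j)))).
exact: ltnW (ltn_trans h3 (ltn_trans h2 (leq_trans h1 sF))).
Qed.

Lemma height_le_data S (u : F) : (tree_size (enc_field F) <= S)%N ->
  (tree_size (enc_elt u) <= S)%N -> height_le u (data_height S).
Proof.
move=> sF su.
have leNS : (N <= S)%N by apply: ltnW; apply: leq_trans sF; exact: dim_lt_tree_size.
rewrite [u]coord_ff_basis.
apply: (@height_leW _ _ _ (#|'I_N| * (S + basis_height S))); last first.
  by rewrite card_ord leq_mul2r leNS orbT.
apply: height_le_sum => i; rewrite -mulr_algl; apply: height_leM; last exact: height_le_basis.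
have [rE _ _] := frac_num_den (coord B i u); rewrite [coord _ _ _]rE.
have [] := @frac_size_le (coord B i u) S.
  by apply: leq_trans su; apply/ltnW/(image_lt_tree_size (fun i => enc_ratfun (coord B i u))).
by move=> sn sd; apply: height_le_alg => //; exact: frac_den_neq0.
Qed.

End InputSize.

(** * Computability of the bound *)

Section BoundComputable.
Variable K : fieldType.

Definition computable (g : nat -> nat) := exists p, computes K p g.

Lemma computable_id : computable id.
Proof. by exists PId; exact: computes_id. Qed.

Lemma computable_const c : computable (fun=> c).
Proof. by exists (pconst c); exact: computes_const. Qed.

Lemma computable_add g g' : computable g -> computable g' ->
  computable (fun n => g n + g' n)%N.
Proof. by move=> [p pg] [p' pg']; exists (padd p p') => n; exact: runs_add. Qed.

Lemma computable_mul g g' : computable g -> computable g' ->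
  computable (fun n => g n * g' n)%N.
Proof. by move=> [p pg] [p' pg']; exists (pmul p p') => n; exact: runs_mul. Qed.

Lemma computable_exp g g' : computable g -> computable g' ->
  computable (fun n => g n ^ g' n)%N.
Proof. by move=> [p pg] [p' pg']; exists (pexp p p') => n; exact: runs_exp. Qed.

Lemma computable_succ g : computable g -> computable (fun n => (g n).+1).
Proof. exact: (computable_add (computable_const 1)). Qed.

Create HintDb comp.
#[local] Hint Resolve computable_id computable_const computable_add computable_mul
  computable_exp computable_succ : comp.

Definition input_bound S := exponent_bound S (basis_height S) (data_height S).

Lemma computable_input_bound : computable input_bound.
Proof.
have cid : computable (fun S => S) := computable_id.
have c_bas : computable basis_height by rewrite /basis_height; auto with comp.
have c_dat : computable data_height by rewrite /data_height; auto with comp.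
have c_min : computable minpoly_factor by rewrite /minpoly_factor; auto 10 with comp.
have c_der : computable derivation_factor by rewrite /derivation_factor; auto 10 with comp.
have c_iter : computable iter_factor by rewrite /iter_factor; auto with comp.
have c_log : computable (fun S => log_bound S (basis_height S) (data_height S)).
  by rewrite /log_bound; auto with comp.
have c_nei g g' : computable g -> computable g' ->
    computable (fun S => neighbour_bound S (g S) (g' S)).
  by move=> cg cg'; rewrite /neighbour_bound; auto 12 with comp.
have c_rat : computable (fun S => ratio_bound S (basis_height S) (data_height S)).
  by rewrite /ratio_bound; auto 10 with comp.
have c_one : computable (fun S => first_bound S (basis_height S) (data_height S)).
  by rewrite /first_bound /power_bound; auto 12 with comp.
have c_two : computable (fun S => second_bound S (basis_height S) (data_height S)).
  by rewrite /second_bound /power_bound; auto 14 with comp.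
by rewrite /input_bound /exponent_bound; auto with comp.
Qed.

End BoundComputable.

Lemma slrsN (E : comPzRingType) t (b beta : 'I_t -> E) m :
  slrs (fun j => - b j) beta m = - slrs b beta m.
Proof. by rewrite /slrs -sumrN; apply: eq_bigr => j _; rewrite mulNr. Qed.

Lemma exponents_le (K : closedFieldType) (F : fieldExtType (ratfun K))
    (g d t : nat) (a alpha : 'I_d -> F) (b beta : 'I_t -> F) (f : F) n m :
  [pchar K] =i pred0 -> (0 < d)%N -> (0 < t)%N ->
  (forall i, a i != 0) -> (forall i, alpha i != 0) ->
  (forall j, b j != 0) -> (forall j, beta j != 0) ->
  (forall i, ~ is_const (alpha i)) -> (forall j, ~ is_const (beta j)) ->
  (forall i j, i != j -> ~ is_const (alpha i / alpha j)) ->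
  (forall i j, i != j -> ~ is_const (beta i / beta j)) ->
  f != 0 -> slrs a alpha n - slrs b beta m = f ->
  (maxn n m <= input_bound (tree_size (enc_data g a alpha b beta f)))%N.
Proof.
move=> char0 d0 t0 a0 al0 b0 be0 alnc benc alr ber f0 sum_eq.
set S := tree_size _.
(* The 8 counts the seven [Pair] nodes and the final [Nil] of the list. *)
have SE : S = (tree_size (enc_field F) + tree_size (enc_elts a) +
    tree_size (enc_elts alpha) + tree_size (enc_elts b) +
    tree_size (enc_elts beta) + tree_size (enc_elt f) +
    tree_size (enc_nat K g) + 8)%N.
  by rewrite /S /enc_data /=; lia.
have sF : (tree_size (enc_field F) <= S)%N by rewrite SE; lia.
have leNS : (\dim {:F} <= S)%N.
  by apply: ltnW; apply: leq_trans sF; exact: dim_lt_tree_size.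
have leBH i := height_le_basis i sF.
have hdata k (u : 'I_k -> F) i : (tree_size (enc_elts u) <= S)%N ->
    height_le (u i) (data_height S).
  move=> su; apply: height_le_data => //; apply: leq_trans su.
  exact/ltnW/(image_lt_tree_size (fun i => enc_elt (u i))).
have ha i : height_le (a i) (data_height S) by apply: hdata; rewrite SE; lia.
have hal i : height_le (alpha i) (data_height S) by apply: hdata; rewrite SE; lia.
have hb i : height_le (b i) (data_height S) by apply: hdata; rewrite SE; lia.
have hbe i : height_le (beta i) (data_height S) by apply: hdata; rewrite SE; lia.
have hf : height_le f (data_height S) by apply: height_le_data => //; rewrite SE; lia.
have hNb i : height_le (- b i) (data_height S) by exact: height_leN.
have b0' j : - b j != 0 by rewrite oppr_eq0.
have dtS : (d + t < S)%N.
  have := dim_lt_tree_size (fun i => enc_elt (a i)).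
  have := dim_lt_tree_size (fun i => enc_elt (b i)).
  by rewrite -!/(enc_elts _) SE; lia.
have tdS : (t + d < S)%N by rewrite addnC.
have E1 : slrs a alpha n + slrs (fun j => - b j) beta m = f by rewrite slrsN.
have E2 : slrs (fun j => - b j) beta m + slrs a alpha n = f by rewrite addrC.
pose fb := first_bound S (basis_height S) (data_height S).
(* Whichever exponent is bounded first, the other one follows by taking the two sequences in the
   appropriate order. *)
have main1 : (n <= fb)%N -> (m <= input_bound S)%N.
  exact: second_exponent_le E1.
have main2 : (m <= fb)%N -> (n <= input_bound S)%N.
  exact: second_exponent_le E2.
rewrite geq_max.
have le_first k : (k <= fb)%N -> (k <= input_bound S)%N.
  by move=> le_k; apply: leq_trans le_k (leq_addr _ _).
have : (n <= fb)%N \/ (m <= fb)%N by exact: one_exponent_le E1.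
move=> [le_n|le_m]; first by rewrite le_first //; exact: main1.
by rewrite andbC le_first //; exact: main2.
Qed.

Theorem theorem1 (R : realType) :
  exists p : prog,
  forall (F : fieldExtType (ratfun R[i])) (g : nat) (d t : nat)
    (a alpha : 'I_d -> F) (b beta : 'I_t -> F) (f : F),
  is_genus F g ->
  (0 < d)%N -> (0 < t)%N ->
  (forall i, a i != 0) -> (forall i, alpha i != 0) ->
  (forall j, b j != 0) -> (forall j, beta j != 0) ->
  (forall i, ~ is_const (alpha i)) -> (forall j, ~ is_const (beta j)) ->
  (forall i j, i != j -> ~ is_const (alpha i / alpha j)) ->
  (forall i j, i != j -> ~ is_const (beta i / beta j)) ->
  f != 0 ->
  exists C : nat,
    runs p (enc_data g a alpha b beta f) (enc_nat _ C) /\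
    forall n m : nat, (0 < n)%N -> (0 < m)%N ->
      slrs a alpha n - slrs b beta m = f -> (maxn n m <= C)%N.
Proof.
have [p pE] := computable_input_bound R[i].
(* The program counts the nodes of its input and evaluates [input_bound] at this number; it is fixed
   before F and the data are given. *)
exists (PComp p psize) => F g d t a alpha b beta f _ d0 t0 a0 al0 b0 be0 alnc benc.
move=> alr ber f0.
exists (input_bound (tree_size (enc_data g a alpha b beta f))); split.
  exact: RComp (runs_size _) (pE _).
move=> n m _ _; apply: (@exponents_le R[i]) => //.
exact: Num.Theory.pchar_num.
Qed.
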